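(* Let $0<a<b<\infty$, $\rho>0$, $\alpha>0$, and let $n\in\mathbb{N}$ be such that $\alpha\in(n-1,n)$. Given a function $x\in C^n[a,b]$, for all $t\in[a,b]$ we have $$\mathcal{I}_{a+}^{\alpha,\rho}\,{^C\mathcal{D}_{a+}^{\alpha,\rho}} x(t)=x(t)-\sum_{k=0}^{n-1}\frac{\rho^{-k}}{k!}(t^\rho-a^\rho)^kx_{(k)}(a)$$ and $$\mathcal{I}_{b-}^{\alpha,\rho}\,{^C\mathcal{D}_{b-}^{\alpha,\rho}} x(t)=x(t)-\sum_{k=0}^{n-1}\frac{\rho^{-k}(-1)^k}{k!}(b^\rho-t^\rho)^kx_{(k)}(b).$$
   Context: $C^n[a,b]$ is the set of functions $x:[a,b]\to\mathbb{R}$ such that $x^{(n)}$ exists and is continuous on $[a,b]$. Notation: $x_{(k)}(t):=\left(t^{1-\rho}\frac{d}{dt}\right)^k x(t)$ (so $x_{(0)}=x$). For $\beta>0$ and an integrable function $x$, the left-sided and right-sided Katugampola fractional integrals of order $\beta$ and parameter $\rho$ are $$\mathcal{I}_{a+}^{\beta,\rho}x(t)=\frac{\rho^{1-\beta}}{\Gamma(\beta)}\int_a^t \tau^{\rho-1}(t^\rho-\tau^\rho)^{\beta-1}x(\tau)\, d\tau,\qquad \mathcal{I}_{b-}^{\beta,\rho}x(t)=\frac{\rho^{1-\beta}}{\Gamma(\beta)}\int_t^b \tau^{\rho-1}(\tau^\rho-t^\rho)^{\beta-1}x(\tau)\, d\tau.$$ The left-sided and right-sided Caputo-Katugampola fractional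 derivatives of order $\alpha\in(n-1,n)$ and parameter $\rho$ are $${^C\mathcal{D}_{a+}^{\alpha,\rho}}x(t)=\mathcal{I}_{a+}^{n-\alpha,\rho}\left(t^{1-\rho}\frac{d}{dt}\right)^n x(t)=\frac{\rho^{1-n+\alpha}}{\Gamma(n-\alpha)}\int_a^t \tau^{\rho-1}(t^\rho-\tau^\rho)^{n-\alpha-1}\left(\tau^{1-\rho}\frac{d}{d\tau}\right)^n x(\tau)\, d\tau,$$ $${^C\mathcal{D}_{b-}^{\alpha,\rho}}x(t)=\mathcal{I}_{b-}^{n-\alpha,\rho}\left(-t^{1-\rho}\frac{d}{dt}\right)^n x(t)=\frac{\rho^{1-n+\alpha}}{\Gamma(n-\alpha)}\int_t^b \tau^{\rho-1}(\tau^\rho-t^\rho)^{n-\alpha-1}\left(-\tau^{1-\rho}\frac{d}{d\tau}\right)^n x(\tau)\, d\tau.$$ *)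

(* Defs.v *)
From HB Require Import structures.
From mathcomp Require Import all_boot all_order all_algebra.
From mathcomp Require Import all_classical all_reals all_analysis.

Set Implicit Arguments.
Unset Strict Implicit.
Unset Printing Implicit Defensive.

Import Order.TTheory GRing.Theory Num.Theory.
Import numFieldNormedType.Exports.

Local Open Scope classical_set_scope.
Local Open Scope ring_scope.

Section CalculusOnInterval.
Context {R : realType}.
Variables (a b : R).

(* Functions on [a, b] are encoded as total functions R -> R.  The derivative
   at t is the limit of difference quotients at points of [a, b] only, hence
   one-sided at a and b; on [a, b] it depends only on the values of f there. *)
Definition diff_quot_at (f : R -> R) (t : R) : set_system R :=
  (f s - f t) / (s - t) @[s --> within `[a, b] t^'].

Definition derivable_itv (f : R -> R) (t : R) : Prop := cvg (diff_quot_at f t).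

Definition derive_itv (f : R -> R) (t : R) : R := lim (diff_quot_at f t).

Definition derive_itvn (k : nat) (f : R -> R) : R -> R := iter k derive_itv f.

Definition is_Cn (n : nat) (f : R -> R) : Prop :=
  (forall k, (k < n)%N -> forall t, t \in `[a, b] ->
     derivable_itv (derive_itvn k f) t) /\
  {within `[a, b], continuous (derive_itvn n f)}.

End CalculusOnInterval.

Section Katugampola.
Context {R : realType}.
Notation mu := (@lebesgue_measure R).

Definition Gamma (z : R) : R :=
  \int[mu]_(s in `[0, +oo[) (s `^ (z - 1) * expR (- s)).

(* At the endpoint where the base of the power of order beta - 1 < 0 vanishes,
   powR takes the value 0; this is a null set for the integrals. *)
Definition kat_int_left (a beta rho : R) (x : R -> R) (t : R) : R :=
  rho `^ (1 - beta) / Gamma beta *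
  \int[mu]_(tau in `[a, t])
    (tau `^ (rho - 1) * (t `^ rho - tau `^ rho) `^ (beta - 1) * x tau).

Definition kat_int_right (b beta rho : R) (x : R -> R) (t : R) : R :=
  rho `^ (1 - beta) / Gamma beta *
  \int[mu]_(tau in `[t, b])
    (tau `^ (rho - 1) * (tau `^ rho - t `^ rho) `^ (beta - 1) * x tau).

Definition kat_diff (a b rho : R) (x : R -> R) : R -> R :=
  fun t => t `^ (1 - rho) * derive_itv a b x t.

Definition kat_diffn (a b rho : R) (k : nat) (x : R -> R) : R -> R :=
  iter k (kat_diff a b rho) x.

Definition kat_diff_opp (a b rho : R) (x : R -> R) : R -> R :=
  fun t => - (t `^ (1 - rho)) * derive_itv a b x t.

Definition kat_diff_oppn (a b rho : R) (k : nat) (x : R -> R) : R -> R :=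
  iter k (kat_diff_opp a b rho) x.

(* Order alpha in ]n - 1, n[ ; n is passed explicitly. *)
Definition caputo_kat_left (a b : R) (n : nat) (alpha rho : R) (x : R -> R) :
    R -> R :=
  kat_int_left a (n%:R - alpha) rho (kat_diffn a b rho n x).

Definition caputo_kat_right (a b : R) (n : nat) (alpha rho : R) (x : R -> R) :
    R -> R :=
  kat_int_right b (n%:R - alpha) rho (kat_diff_oppn a b rho n x).

End Katugampola.

(* Main.v *)
Require Import Defs.
From HB Require Import structures.
From mathcomp Require Import all_boot all_order all_algebra.
From mathcomp Require Import all_classical all_reals all_analysis.
From mathcomp Require Import ring lra.
From mathcomp Require Import measurable_realfun.
Import Order.TTheory GRing.Theory Num.Theory.
Import numFieldNormedType.Exports.
Local Open Scope classical_set_scope.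
Local Open Scope ring_scope.

(** The two halves of the statement have the same structure.  Write D for the
    operator t^(1-rho) d/dt; let y be D^n x for the left-sided formula and
    (-D)^n x = (-1)^n D^n x for the right-sided one.

    First, the Katugampola integrals form a semigroup: the integral of order
    alpha applied to the integral of order n - alpha of y is the integral of
    order n of y.  Exchanging the two integrations reduces this to a formula
    for the composition of two kernels,
      int_s^t (P t - P r)^(p-1) (P r - P s)^(q-1) P'(r) dr
        = B(p,q) (P t - P s)^(p+q-1),      with P r = r^rho,
    which the substitution v = (P r - P s) / (P t - P s) turns into the
    definition of the Beta integral B(p,q) (integral_beta_kernel).  The
    normalizing constants then match because of the Euler relation
    Gamma(p) Gamma(q) = B(p,q) Gamma(p+q) (GammaM).  That relation is itself an
    instance of the same kernel formula, with P the identity, combined with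
    Tonelli's theorem for e^(-s-u).  It holds with infinite values allowed;
    taking q = 1 gives the functional equation of Gamma, hence
    Gamma(n) = (n-1)!, and taking q with p + q an integer shows that Gamma(p)
    is finite, because B(p,q) is.

    Second, since n is an integer, the integral of order n of D^n x has an
    explicit primitive.  For fixed t, the Taylor sum
      T(s) = sum_(k < n) rho^-k / k! (t^rho - s^rho)^k (D^k x)(s),
    as a function of the expansion point s, has the telescoping derivative
      T'(s) = rho^-(n-1) / (n-1)! (t^rho - s^rho)^(n-1) s^(rho-1) (D^n x)(s)
    (has_derive_taylor_kat).  Since T(t) = x(t), integrating T' over [a,t]
    gives the left-sided formula, and over [t,b] the right-sided one, the
    signs (-1)^k coming from t^rho - b^rho = - (b^rho - t^rho).

    Two devices keep the sides together.  Truncated powers, which vanish on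
    the nonpositive half-line, turn integrals over [a,t] or [t,b] into
    integrals over the fixed interval [a,b]; and both families of kernels
    satisfy the same interface (kernel_semigroup), for which the composition
    theorem is proved once (kernel_operator_comp). *)

(** * Substitution on open intervals, without continuity at the endpoints *)

(** The integrands below are singular at the endpoints of the interval, where
    substitution on a segment does not apply.  On each segment [u n, v n] it
    does, and monotone convergence passes to the union. *)
Lemma ge0_integration_by_substitution_exhaust (R : realType) (F f G : R -> R)
    (u v : nat -> R) (D : set R) :
  (forall n, u n < v n) ->
  {homo u : m n / (m <= n)%N >-> n <= m} ->
  {homo v : m n / (m <= n)%N >-> m <= n} ->
  D = \bigcup_n `[u n, v n]%classic ->
  {in D &, {homo F : x y / x < y}} ->
  (forall x, D x -> is_derive x 1 F (f x)) ->
  (forall x, D x -> {for x, continuous f}) ->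
  (forall x, D x -> 0 <= f x) ->
  (forall x, D x -> {for F x, continuous G}) ->
  (forall x, D x -> 0 <= G (F x)) ->
  (\int[lebesgue_measure]_(y in F @` D) (G y)%:E =
   \int[lebesgue_measure]_(x in D) (G (F x) * f x)%:E)%E.
Proof.
move=> uv uN vN DE incF dF cf f0 cG G0.
have segD n x : `[u n, v n]%classic x -> D x by rewrite DE => ?; exists n.
have cFx x : D x -> {for x, continuous F}.
  by move=> /dF ?; apply/differentiable_continuous/derivable1_diffP.
have cF n : {within `[u n, v n], continuous F}.
  by apply: continuous_in_subspaceT => x /set_mem /segD /cFx.
have un n : u n \in D by apply/mem_set/(segD n); rewrite /= in_itv/= lexx ltW.
have vn n : v n \in D by apply/mem_set/(segD n); rewrite /= in_itv/= lexx ltW.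
have Fuv n : F (u n) < F (v n) by apply: incF.
have homoF x y : D x -> D y -> x <= y -> F x <= F y.
  move=> Dx Dy; rewrite le_eqVlt => /predU1P[->//|xy].
  by apply/ltW/incF => //; exact/mem_set.
have Fseg n : F @` `[u n, v n]%classic = `[F (u n), F (v n)]%classic.
  apply/seteqP; split => [_ [x xuv <-]|y] /=.
    have := xuv; rewrite /= !in_itv/= => /andP[ux xv].
    by rewrite !homoF//; [exact: segD xuv|exact: set_mem|exact: set_mem|exact: segD xuv].
  rewrite in_itv/= => /andP[uy yv].
  have [|c cuv <-] := @IVT R F (u n) (v n) y (ltW (uv n)) (cF n).
    by rewrite ge_min uy le_max yv orbT.
  by exists c.
have FDE : F @` D = \bigcup_n `[F (u n), F (v n)]%classic.
  by rewrite DE image_bigcup; apply: eq_bigcupr => n _; rewrite Fseg.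
have cGn n : {within `[F (u n), F (v n)], continuous G}.
  apply: continuous_in_subspaceT => y /set_mem; rewrite -Fseg => -[x xuv <-].
  by apply: cG; exact: segD xuv.
have cGFf n : {within `[u n, v n], continuous (fun x => G (F x) * f x)}.
  apply: continuous_in_subspaceT => y /set_mem /segD Dy.
  apply: (@cvgM _ _ _ _ (G \o F) f); last exact: cf.
  by apply: (@continuous_comp _ _ _ F G); [exact: cFx|exact: cG].
have Iuv n : (\int[lebesgue_measure]_(y in `[F (u n), F (v n)]) (G y)%:E =
   \int[lebesgue_measure]_(x in `[u n, v n]) (G (F x) * f x)%:E)%E.
  have F'E x : D x -> F^`()%classic x = f x.
    by move=> /dF dFx; rewrite derive1E; apply: derive_val.
  rewrite integration_by_substitution_increasing//.
  - by apply: eq_integral => x /set_mem xuv; rewrite !fctE F'E//; exact: segD xuv.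
  - exact: ltW.
  - by move=> x y xuv yuv; apply: incF; apply/mem_set/(segD n).
  - move=> x xuv.
    have Dx : D x by apply: (segD n) => /=; exact: subset_itv_oo_cc xuv.
    rewrite /prop_for /continuous_at F'E//.
    apply: cvg_trans (cf _ Dx); apply: near_eq_cvg.
    near=> y; rewrite F'E//; apply: (segD n) => /=; apply: subset_itv_oo_cc.
    by near: y; exact: near_in_itvoo.
  - apply/cvg_ex; exists (f (u n)).
    apply: cvg_trans (cvg_at_right_filter (cf _ (set_mem (un n)))).
    apply: near_eq_cvg; near=> y; rewrite F'E//; apply: (segD n) => /=.
    by rewrite in_itv/=; apply/andP; split; [exact: ltW|near: y; exact: nbhs_right_le].
  - apply/cvg_ex; exists (f (v n)).
    apply: cvg_trans (cvg_at_left_filter (cf _ (set_mem (vn n)))).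
    apply: near_eq_cvg; near=> y; rewrite F'E//; apply: (segD n) => /=.
    by rewrite in_itv/=; apply/andP; split; [near: y; exact: nbhs_left_ge|exact: ltW].
  - split.
    + move=> x xuv; apply: ex_derive; apply: dF.
      by apply: (segD n) => /=; exact: subset_itv_oo_cc xuv.
    + by apply: cvg_at_right_filter; apply: cFx; exact: set_mem.
    + by apply: cvg_at_left_filter; apply: cFx; exact: set_mem.
rewrite FDE [in RHS]DE.
have c1 := @ge0_nondecreasing_set_cvg_integral _ (measurableTypeR R) R
  (fun n => `[F (u n), F (v n)]%classic) (fun y => (G y)%:E) (@lebesgue_measure R).
have c2 := @ge0_nondecreasing_set_cvg_integral _ (measurableTypeR R) R
  (fun n => `[u n, v n]%classic) (fun x => (G (F x) * f x)%:E) (@lebesgue_measure R).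
apply: (cvg_unique _ (c1 _ _ _ _)) => //.
- move=> m n mn; apply/subsetPset; apply: subset_itvScc.
    by apply: homoF; [exact: set_mem|exact: set_mem|exact: uN].
  by apply: homoF; [exact: set_mem|exact: set_mem|exact: vN].
- by move=> n; apply/measurable_EFinP; exact: subspace_continuous_measurable_fun.
- by move=> n y; rewrite -Fseg => -[x /segD Dx <-]; rewrite lee_fin; exact: G0.
- rewrite [X in X @ _](_ : _ = fun n =>
    (\int[lebesgue_measure]_(x in `[u n, v n]) (G (F x) * f x)%:E)%E); last first.
    by apply/funext => n; exact: Iuv.
  apply: c2 => //=.
  + move=> m n mn; apply/subsetPset; apply: subset_itvScc; first exact: uN.
    exact: vN.
  + by move=> n; apply/measurable_EFinP; exact: subspace_continuous_measurable_fun.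
  + by move=> n x /segD Dx; rewrite lee_fin mulr_ge0 ?G0 ?f0.
Unshelve. all: by end_near. Qed.

(** Only F has to extend to the endpoints; this is what identifies the image
    of the open interval. *)
Lemma ge0_integration_by_substitution_oo (R : realType) (F f G : R -> R)
    (a b : R) :
  a < b ->
  {within `[a, b], continuous F} ->
  {in `[a, b] &, {homo F : x y / x < y}} ->
  {in `]a, b[, forall x : R, is_derive x 1 F (f x)} ->
  {in `]a, b[, continuous f} ->
  {in `]a, b[, forall x, 0 <= f x} ->
  {in `]F a, F b[, continuous G} ->
  {in `]F a, F b[, forall y, 0 <= G y} ->
  (\int[lebesgue_measure]_(y in `]F a, F b[) (G y)%:E =
   \int[lebesgue_measure]_(x in `]a, b[) (G (F x) * f x)%:E)%E.
Proof.
move=> ab cF incF dF cf f0 cG G0.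
have FabE : F @` `]a, b[%classic = `]F a, F b[%classic.
  apply/seteqP; split => [|y]; first exact: increasing_image_oo.
  rewrite /= in_itv/= => /andP[ay yb].
  have [|c] := @IVT R F a b y (ltW ab) cF.
    by rewrite ge_min (ltW ay) le_max (ltW yb) orbT.
  rewrite in_itv/= => /andP[ac cb] Fcy; exists c => //=.
  rewrite in_itv/= !lt_neqAle ac cb !andbT; apply/andP; split.
    by apply: contraTneq ay => ->; rewrite Fcy ltxx.
  by apply: contraTneq yb => <-; rewrite Fcy ltxx.
have Foo x : x \in `]a, b[ -> F x \in `]F a, F b[.
  by move=> xab; have : (F @` `]a, b[%classic) (F x) by [exists x]; rewrite FabE.
rewrite -FabE.
(* With denominators at least 3, the two margins never meet. *)
pose w (n : nat) : R := (b - a) / n.+3%:R.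
have w0 n : 0 < w n by rewrite divr_gt0// subr_gt0.
have w2 n : w n + w n < b - a.
  rewrite /w -mulrDl ltr_pdivrMr// -mulr2n -[ltLHS]mulr_natr ltr_pM2l ?subr_gt0//.
  by rewrite ltr_nat.
have wN m n : (m <= n)%N -> w n <= w m.
  by move=> mn; rewrite ler_pM2l ?subr_gt0// lef_pV2 ?posrE// ler_nat.
apply: (@ge0_integration_by_substitution_exhaust R F f G
  (fun n => a + w n) (fun n => b - w n)).
- by move=> n; have := w2 n; lra.
- by move=> m n /wN; lra.
- by move=> m n /wN; lra.
- apply/seteqP; split => [x|x [n _]] /=; last first.
    by rewrite !in_itv/= => /andP[]; have := w0 n; lra.
  rewrite in_itv/= => /andP[ax xb].
  pose d := Num.min (x - a) (b - x).
  have d0 : 0 < d by rewrite /d lt_min !subr_gt0 ax xb.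
  pose n := Num.truncn ((b - a) / d); exists n => //=.
  have wd : w n < d.
    rewrite /w ltr_pdivrMr// mulrC -ltr_pdivrMr//.
    apply: (lt_le_trans (truncnS_gt _)).
    by rewrite ler_nat -addn2 leq_addr.
  move: wd; rewrite /d lt_min => /andP[wx wb].
  by rewrite in_itv/=; lra.
- by move=> x y /set_mem xab /set_mem yab; apply: incF; exact: subset_itv_oo_cc.
- by move=> x xab; exact: dF.
- by move=> x xab; exact: cf.
- by move=> x xab; exact: f0.
- by move=> x xab; apply: cG; exact: Foo.
- by move=> x xab; apply: G0; exact: Foo.
Qed.

(** * The Beta integral and the composition of power kernels *)

(** Extended-real valued, so that Tonelli's theorem can be applied to it before
    its finiteness is known. *)
Definition beta (R : realType) (p q : R) : \bar R :=
  (\int[lebesgue_measure]_(v in `]0%R, 1%R[)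
     ((1 - v) `^ (p - 1) * v `^ (q - 1))%:E)%E.

Lemma continuous_powR (R : realType) (r x : R) : 0 < x ->
  {for x, continuous (@powR R ^~ r)}.
Proof.
move=> x0; apply/differentiable_continuous/derivable1_diffP.
by apply: derivable_powR; rewrite in_itv/= x0.
Qed.

Lemma is_derive_powR (R : realType) (r x : R) : 0 < x ->
  is_derive x 1 (@powR R ^~ r) (r * x `^ (r - 1)).
Proof.
move=> x0; have xy : x \in `]0, +oo[ by rewrite in_itv/= x0.
rewrite -(powR_derive1 r xy) derive1E; apply: DeriveDef => //.
exact: derivable_powR.
Qed.

(** The substitution v = (P x - P s) / (P t - P s) maps ]s, t[ onto ]0, 1[; the
    three factors contribute p - 1, q - 1 and 1 to the exponent of P t - P s. *)
Lemma integral_beta_kernel (R : realType) (p q : R) (P dP : R -> R) (s t : R) :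
  s < t ->
  {within `[s, t], continuous P} ->
  {in `[s, t] &, {homo P : x y / x < y}} ->
  {in `]s, t[, forall x : R, is_derive x 1 P (dP x)} ->
  {in `]s, t[, continuous dP} ->
  {in `]s, t[, forall x, 0 <= dP x} ->
  (\int[lebesgue_measure]_(x in `]s, t[)
     ((P t - P x) `^ (p - 1) * (P x - P s) `^ (q - 1) * dP x)%:E =
   beta R p q * ((P t - P s) `^ (p + q - 1))%:E)%E.
Proof.
move=> st cP incP derP cdP dP0.
have sst : s \in `[s, t] by rewrite in_itv/= lexx ltW.
have tst : t \in `[s, t] by rewrite in_itv/= lexx ltW.
have L0 : 0 < P t - P s by rewrite subr_gt0 incP.
set L := P t - P s in L0 *.
pose F x := (P x - P s) / L; pose f x := dP x / L.
pose G (v : R) := (1 - v) `^ (p - 1) * v `^ (q - 1).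
have Fs : F s = 0 by rewrite /F subrr mul0r.
have Ft : F t = 1 by rewrite /F divff// gt_eqF.
have Pst x : x \in `]s, t[ -> P s < P x < P t.
  move=> xst; have xst' : x \in `[s, t] by exact: subset_itv_oo_cc xst.
  by move: xst; rewrite in_itv/= => /andP[sx xt]; rewrite !incP.
have cG : {in `]0, 1[, continuous G}.
  move=> v; rewrite in_itv/= => /andP[v0 v1].
  apply: cvgM; last exact: continuous_powR.
  apply: (@continuous_comp _ _ _ (fun u : R => 1 - u) (@powR R ^~ (p - 1))).
    by apply: cvgB; [exact: cvg_cst|exact: cvg_id].
  by apply: continuous_powR; rewrite subr_gt0.
have betaE : beta R p q =
    (\int[lebesgue_measure]_(x in `]s, t[) (G (F x) * f x)%:E)%E.
  have := @ge0_integration_by_substitution_oo R F f G s t; rewrite Fs Ft.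
  apply => //.
  - move=> x; apply: cvgM; last exact: cvg_cst.
    by apply: cvgB; [exact: cP|exact: cvg_cst].
  - by move=> x y xst yst xy; rewrite /F ltr_pM2r ?invr_gt0// ltrD2r incP.
  - move=> x /derP derPx; rewrite /F /f.
    have -> : (fun x => (P x - P s) / L) = L^-1 *: (P - cst (P s)).
      by apply/funext => z /=; rewrite !fctE mulrC.
    by apply: is_derive_eq; rewrite subr0 mulrC.
  - by move=> x xst; apply: cvgM; [exact: cdP|exact: cvg_cst].
  - by move=> x /dP0 dP0x; rewrite divr_ge0// ltW.
  - by move=> v _; rewrite mulr_ge0// powR_ge0.
rewrite betaE muleC -ge0_integralZl_EFin//=; first last.
- by rewrite powR_ge0.
- apply/measurable_EFinP.
  apply: open_continuous_measurable_fun; first exact: interval_open.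
  move=> x /set_mem xst.
  apply: cvgM; last by apply: cvgM; [exact: cdP|exact: cvg_cst].
  have cFx : {for x, continuous F}.
    apply: cvgM; last exact: cvg_cst.
    apply: cvgB; last exact: cvg_cst.
    by apply/differentiable_continuous/derivable1_diffP; apply: ex_derive; exact: derP.
  apply: (@continuous_comp _ _ _ F G) => //; apply: cG.
  have /andP[sx xt] := Pst _ xst.
  rewrite in_itv/= /F divr_gt0 ?subr_gt0 ?(lt_trans sx xt)//=.
  by rewrite ltr_pdivrMr// mul1r ltrD2r.
- move=> x /dP0 dP0x; rewrite lee_fin /G /f !mulr_ge0 ?powR_ge0// invr_ge0; exact: ltW.
apply: eq_integral => x /set_mem xst; congr EFin.
have /andP[sx xt] := Pst _ xst.
have PtxE : P t - P x = L * (1 - F x).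
  by rewrite /F mulrBr mulr1 mulrCA divff ?gt_eqF// mulr1 /L; ring.
have PxsE : P x - P s = L * F x by rewrite /F mulrCA divff ?gt_eqF// mulr1.
have F0 : 0 < F x by rewrite divr_gt0// subr_gt0.
have F1 : 0 < 1 - F x by rewrite subr_gt0 /F ltr_pdivrMr// mul1r ltrD2r.
rewrite PtxE PxsE (powRM _ (ltW L0) (ltW F1)) (powRM _ (ltW L0) (ltW F0)).
have -> : p + q - 1 = (p - 1) + (q - 1) + 1 by ring.
have L1 : L != 0 by rewrite gt_eqF.
rewrite (@powRD _ L (p - 1 + (q - 1))) ?L1 ?implybT//.
rewrite (@powRD _ L (p - 1)) ?L1 ?implybT// powRr1 ?(ltW L0)// /G /f.
by field.
Qed.

(** The fundamental theorem for a derivative that may be unbounded near s and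
    t: the kernel formula for p = q = 1, where both kernels are constant. *)
Lemma ge0_integral_derive_oo (R : realType) (P dP : R -> R) (s t : R) :
  s < t ->
  {within `[s, t], continuous P} ->
  {in `[s, t] &, {homo P : x y / x < y}} ->
  {in `]s, t[, forall x : R, is_derive x 1 P (dP x)} ->
  {in `]s, t[, continuous dP} ->
  {in `]s, t[, forall x, 0 <= dP x} ->
  (\int[lebesgue_measure]_(x in `]s, t[) (dP x)%:E = (P t - P s)%:E)%E.
Proof.
move=> st cP incP derP cdP dP0.
have := @integral_beta_kernel R 1 1 P dP s t st cP incP derP cdP dP0.
have -> : beta R 1 1 = 1%E.
  rewrite /beta; under eq_integral do rewrite subrr !powRr0 mulr1.
  by rewrite integral_cst//= lebesgue_measure_itv/= lte_fin ltr01 oppr0 adde0 mule1.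
rewrite mul1e addrK powRr1 => [<-|].
  by apply: eq_integral => x _; rewrite subrr !powRr0 !mul1r.
by rewrite subr_ge0 ltW// incP// in_itv/= lexx ltW.
Qed.

Lemma integral_powR01 (R : realType) (q : R) : 0 < q ->
  (\int[lebesgue_measure]_(v in `]0%R, 1%R[) (v `^ (q - 1))%:E = q^-1%:E)%E.
Proof.
move=> q0.
have -> : q^-1 = (fun v : R => q^-1 * v `^ q) 1 - (fun v : R => q^-1 * v `^ q) 0.
  by rewrite powR1 mulr1 powR0 ?gt_eqF// mulr0 subr0.
apply: (@ge0_integral_derive_oo R (fun v : R => q^-1 * v `^ q)
  (fun v => v `^ (q - 1))) => //.
- apply/continuous_within_itvP => //; split.
  + move=> x; rewrite in_itv/= => /andP[x0 _].
    by apply: cvgM; [exact: cvg_cst|exact: continuous_powR].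
  + rewrite powR0 ?gt_eqF//.
    by apply: cvgM; [exact: cvg_cst|exact: powR_cvg0].
  + apply: cvgM; first exact: cvg_cst.
    by apply: cvg_at_left_filter; exact: continuous_powR.
- move=> x y; rewrite !in_itv/= => /andP[x0 _] /andP[y0 _] xy.
  by rewrite ltr_pM2l ?invr_gt0// gt0_ltr_powR.
- move=> x; rewrite in_itv/= => /andP[x0 _].
  have dx := @is_derive_powR R q x x0.
  have -> : (fun v : R => q^-1 * v `^ q) = q^-1 *: (@powR R ^~ q) by [].
  by apply: is_derive_eq; rewrite scalerA mulVf ?gt_eqF// scale1r.
- by move=> x; rewrite in_itv/= => /andP[x0 _]; exact: continuous_powR.
- by move=> x _; exact: powR_ge0.
Qed.

Lemma integral_onem_powR01 (R : realType) (q : R) : 0 < q ->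
  (\int[lebesgue_measure]_(v in `]0%R, 1%R[) ((1 - v) `^ (q - 1))%:E = q^-1%:E)%E.
Proof.
move=> q0; pose P (v : R) := - q^-1 * (1 - v) `^ q.
have -> : q^-1 = P 1 - P 0.
  by rewrite /P subr0 subrr powR1 mulr1 powR0 ?gt_eqF// mulr0 add0r opprK.
have cpow (r x : R) : x < 1 -> {for x, continuous (fun v : R => (1 - v) `^ r)}.
  move=> x1; apply: (@continuous_comp _ _ _ (fun u : R => 1 - u) (@powR R ^~ r)).
    by apply: cvgB; [exact: cvg_cst|exact: cvg_id].
  by apply: continuous_powR; rewrite subr_gt0.
apply: (@ge0_integral_derive_oo R P (fun v => (1 - v) `^ (q - 1))) => //.
- apply/continuous_within_itvP => //; split.
  + move=> x; rewrite in_itv/= => /andP[_ x1].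
    by apply: cvgM; [exact: cvg_cst|exact: cpow].
  + apply: cvgM; first exact: cvg_cst.
    by apply: cvg_at_right_filter; exact: cpow.
  + apply: cvgM; first exact: cvg_cst.
    rewrite subrr powR0 ?gt_eqF//.
    apply: (@decreasing_cvg_at_left_comp R (fun v => 1 - v) (@powR R ^~ q)
              (BLeft 0) 1 0) => //.
    * by rewrite bnd_simp.
    * by move=> x y _ _ xy; rewrite ltrD2l ltrN2.
    * apply: cvg_at_left_filter; apply: cvgB; [exact: cvg_cst|exact: cvg_id].
    * by rewrite subrr; exact: powR_cvg0.
- move=> x y; rewrite !in_itv/= => /andP[_ x1] /andP[_ y1] xy.
  rewrite /P !mulNr ltrN2 ltr_pM2l ?invr_gt0// gt0_ltr_powR ?nnegrE ?subr_ge0//.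
  by rewrite ltrD2l ltrN2.
- move=> x; rewrite in_itv/= => /andP[_ x1].
  have x1' : 0 < 1 - x by rewrite subr_gt0.
  have dx := @is_derive_powR R q _ x1'.
  have dB : is_derive x (1 : R) (fun v : R => 1 - v) (-1).
    by apply: is_derive_eq; rewrite add0r mul1r.
  have dcomp := @is_derive1_comp R (@powR R ^~ q) (fun v : R => 1 - v) x _ _ dx dB.
  have -> : P = - q^-1 *: ((@powR R ^~ q) \o (fun v : R => 1 - v)) by [].
  apply: is_derive_eq.
  by rewrite /GRing.scale/=; field; rewrite gt_eqF.
- by move=> x; rewrite in_itv/= => /andP[_ x1]; exact: cpow.
- by move=> x _; exact: powR_ge0.
Qed.

Lemma measurable_onem_powR (R : realType) (r : R) (D : set R) :
  measurable_fun D (fun v : R => (1 - v) `^ r).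
Proof.
apply: measurable_funTS.
apply: (@measurableT_comp _ _ _ _ _ _ (@powR R ^~ r) _
  (fun v : R => 1 - v) (measurable_powR r)).
exact: (measurable_funB (measurable_cst _) (@measurable_id _ _ _)).
Qed.

(** With w = 1 - v, multiplying the integrand by v + w = 1 splits it as
    w^(p-1) v^q + w^p v^(q-1), which is at most w^(p-1) + v^(q-1): one
    singularity at a time. *)
Lemma beta_lty (R : realType) (p q : R) : 0 < p -> 0 < q ->
  (beta R p q < +oo)%E.
Proof.
move=> p0 q0.
have mp : measurable_fun (`]0, 1[%classic : set R) (fun v : R => (1 - v) `^ (p - 1)).
  exact: measurable_onem_powR.
have mq : measurable_fun (`]0, 1[%classic : set R) (fun v : R => v `^ (q - 1)).
  by apply: measurable_funTS; exact: measurable_powR.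
apply: (@le_lt_trans _ _ (\int[lebesgue_measure]_(v in `]0%R, 1%R[)
    (((1 - v) `^ (p - 1))%:E + (v `^ (q - 1))%:E))%E).
  apply: ge0_le_integral => //=.
  - by move=> v _; rewrite lee_fin mulr_ge0 ?powR_ge0.
  - by apply/measurable_EFinP; apply: measurable_funM.
  - by apply/measurable_EFinP; apply: measurable_funD.
  move=> v; rewrite in_itv/= => /andP[v0 v1]; rewrite lee_fin.
  have w0 : 0 < 1 - v by rewrite subr_gt0.
  have -> : (1 - v) `^ (p - 1) * v `^ (q - 1) =
      (1 - v) `^ (p - 1) * (v * v `^ (q - 1)) +
      ((1 - v) * (1 - v) `^ (p - 1)) * v `^ (q - 1) by ring.
  rewrite !mulr_powRB1 ?(ltW v0) ?(ltW w0)//.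
  have le1 (r u : R) : 0 < r -> 0 < u -> u <= 1 -> u `^ r <= 1.
    move=> r0 u0 u1; rewrite -[leRHS](powRr0 u); apply: ger_powR; last exact: ltW.
    by rewrite u0 u1.
  apply: lerD; first by rewrite ler_piMr ?powR_ge0// le1// ltW.
  by rewrite ler_piMl ?powR_ge0// le1// lerBlDr lerDl ltW.
rewrite ge0_integralD//.
- by rewrite integral_powR01// integral_onem_powR01// ltry.
- by move=> v _; rewrite lee_fin powR_ge0.
- exact/measurable_EFinP.
- by move=> v _; rewrite lee_fin powR_ge0.
- exact/measurable_EFinP.
Qed.

Lemma beta_ge0 (R : realType) (p q : R) : (0 <= beta R p q)%E.
Proof.
by apply: integral_ge0 => v _; rewrite lee_fin mulr_ge0// powR_ge0.
Qed.

Lemma beta_fin_num (R : realType) (p q : R) : 0 < p -> 0 < q ->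
  beta R p q \is a fin_num.
Proof. by move=> p0 q0; rewrite ge0_fin_numE ?beta_ge0// beta_lty. Qed.

(** * Truncated powers *)

(** The indicator is needed because powR is 1, not 0, at negative arguments
    (its logarithm is 0 there). *)
Definition truncated_power (R : realType) (p x : R) : R :=
  \1_(`]0, +oo[%classic : set R) x * x `^ (p - 1).

Lemma truncated_power_gt0 (R : realType) (p x : R) : 0 < x ->
  truncated_power R p x = x `^ (p - 1).
Proof.
by move=> x0; rewrite /truncated_power indicE mem_set ?mul1r//= in_itv/= x0.
Qed.

Lemma truncated_power_le0 (R : realType) (p x : R) : x <= 0 ->
  truncated_power R p x = 0.
Proof.
move=> x0; rewrite /truncated_power indicE memNset ?mul0r//= in_itv/= andbT.
by apply/negP; rewrite -leNgt.
Qed.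

Lemma truncated_power_ge0 (R : realType) (p x : R) : 0 <= truncated_power R p x.
Proof. by rewrite mulr_ge0// powR_ge0. Qed.

Lemma measurable_truncated_power (R : realType) (p : R) (D : set R) :
  measurable_fun D (truncated_power R p).
Proof.
apply: measurable_funTS; apply: measurable_funM; last exact: measurable_powR.
exact: measurable_indic.
Qed.

(** As P increases on D, the integrand is supported in ]s, t[: the integral does
    not depend on how far D extends beyond it.  When t <= s both sides vanish,
    whatever the value of beta. *)
Lemma integral_truncated_powerM (R : realType) (p q : R) (P dP : R -> R)
    (D : set R) (s t : R) :
  D s -> D t -> `[s, t]%classic `<=` D ->
  {in D &, {homo P : x y / x < y}} ->
  {within `[s, t], continuous P} ->
  {in `]s, t[, forall x : R, is_derive x 1 P (dP x)} ->
  {in `]s, t[, continuous dP} ->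
  {in `]s, t[, forall x, 0 <= dP x} ->
  (\int[lebesgue_measure]_(x in D)
     (truncated_power R p (P t - P x) * dP x * truncated_power R q (P x - P s))%:E =
   beta R p q * (truncated_power R (p + q) (P t - P s))%:E)%E.
Proof.
move=> Ds Dt stD incP cP derP cdP dP0.
have leP x y : D x -> D y -> x <= y -> P x <= P y.
  move=> Dx Dy; rewrite le_eqVlt => /predU1P[->//|xy].
  by apply/ltW/incP => //; exact/mem_set.
have out x : D x -> x \notin `]s, t[ ->
    truncated_power R p (P t - P x) * dP x * truncated_power R q (P x - P s) = 0.
  move=> Dx; rewrite in_itv/= negb_and -!leNgt => /orP[xs|tx].
    by rewrite [X in _ * X]truncated_power_le0 ?mulr0// subr_le0 leP.
  by rewrite truncated_power_le0 ?mul0r// subr_le0 leP.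
have [st|ts] := ltP s t; last first.
  rewrite truncated_power_le0 ?mule0; last by rewrite subr_le0 leP.
  apply: integral0_eq => x Dx; rewrite out//.
  rewrite in_itv/=; apply/negP => /andP[sx xt].
  by have := lt_trans sx xt; rewrite ltNge ts.
have Pst : P s < P t by apply: incP => //; exact/mem_set.
rewrite [in RHS]truncated_power_gt0 ?subr_gt0//.
have incP' : {in `[s, t] &, {homo P : x y / x < y}}.
  by move=> x y xst yst; apply: incP; exact/mem_set/stD.
rewrite -(@integral_beta_kernel R p q P dP s t)//.
rewrite integral_mkcond [RHS]integral_mkcond; apply: eq_integral => x _.
rewrite !patchE; case: ifPn => [/set_mem Dx|xD]; last first.
  rewrite ifF//; apply/negP => /set_mem xst; move/negP: xD; apply.
  by apply/mem_set/stD => /=; exact: subset_itv_oo_cc xst.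
have [xst|xst] := boolP (x \in `]s, t[); last first.
  by rewrite out// ifF//; apply/negP => /set_mem; exact/negP.
rewrite ifT; last exact/mem_set.
have := xst; rewrite in_itv/= => /andP[sx xt].
rewrite !truncated_power_gt0 ?subr_gt0; first by congr EFin; rewrite mulrAC.
  by apply: incP => //; exact/mem_set.
by apply: incP => //; exact/mem_set.
Qed.

Lemma integral_truncated_power_conv (R : realType) (p q v : R) :
  (\int[lebesgue_measure]_x
     (truncated_power R p (v - x) * truncated_power R q x)%:E =
   beta R p q * (truncated_power R (p + q) v)%:E)%E.
Proof.
have cid (A : set R) : {within A, continuous (@id R)}.
  by apply: continuous_subspaceT => x; exact: cvg_id.
have c1 : {in `]0, v[, continuous (cst 1 : R -> R)} by move=> x _; exact: cvg_cst.
have H := @integral_truncated_powerM R p q id (cst 1) setT 0 v I I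
  (fun _ _ => I) (fun _ _ _ _ => id) (cid _) (fun x _ => is_derive_id _ _) c1
  (fun _ _ => ler01).
transitivity (beta R p q * (truncated_power R (p + q) (v - 0))%:E)%E; last first.
  by rewrite subr0.
by rewrite -[RHS]H; apply: eq_integral => x _; rewrite mulr1 subr0.
Qed.

(** * The Gamma function *)

(** The Gamma integral before its conversion to a real number, written over the
    whole line so that it can be translated. *)
Definition egamma (R : realType) (z : R) : \bar R :=
  (\int[lebesgue_measure]_x (truncated_power R z x * expR (- x))%:E)%E.

Lemma measurable_gamma_integrand (R : realType) (z : R) (D : set R) :
  measurable_fun D (fun x : R => truncated_power R z x * expR (- x)).
Proof.
apply: measurable_funM; first exact: measurable_truncated_power.
by apply: measurable_funTS; apply: measurableT_comp.
Qed.

Lemma gamma_integrand_ge0 (R : realType) (z x : R) :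
  (0 <= (truncated_power R z x * expR (- x))%:E)%E.
Proof. by rewrite lee_fin mulr_ge0 ?truncated_power_ge0 ?expR_ge0. Qed.

Lemma egamma_translate (R : realType) (z s : R) :
  (\int[lebesgue_measure]_x (truncated_power R z (x - s) * expR (- (x - s)))%:E
   = egamma R z)%E.
Proof.
pose G (x : R) := truncated_power R z x * expR (- x).
have cG (u : R) : 0 < u -> {for u, continuous G}.
  move=> u0; rewrite /prop_for /continuous_at {2}/G truncated_power_gt0//.
  have : (fun y : R => y `^ (z - 1) * expR (- y)) y @[y --> u] -->
      u `^ (z - 1) * expR (- u).
    apply: cvgM; first exact: continuous_powR.
    apply: (@continuous_comp _ _ _ (@GRing.opp R) (@expR R)).
      exact: oppr_continuous.
    exact: continuous_expR.
  apply: cvg_trans; apply: near_eq_cvg; near=> y.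
  by rewrite /G truncated_power_gt0//; near: y; exact: lt_nbhsr.
have mkpos c : (\int[lebesgue_measure]_x (G (x - c))%:E =
    \int[lebesgue_measure]_(x in `]c, +oo[) (G (x - c))%:E)%E.
  rewrite [RHS]integral_mkcond; apply: eq_integral => x _; rewrite patchE.
  case: ifPn => // /negP xc; rewrite /G truncated_power_le0 ?mul0r//.
  rewrite subr_le0 leNgt; apply/negP => cx; apply: xc; apply/mem_set.
  by rewrite /= in_itv/= cx.
transitivity (\int[lebesgue_measure]_x (G (x - 0))%:E)%E; last first.
  by apply: eq_integral => x _; rewrite subr0.
rewrite (mkpos s) (mkpos 0).
have imE : (fun x : R => x - s) @` `]s, +oo[%classic = `]0, +oo[%classic.
  apply/seteqP; split => [_ [x sx <-]|x].
    by move: sx; rewrite /= !in_itv/= !andbT subr_gt0.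
  rewrite /= in_itv/= andbT => x0; exists (x + s); last by rewrite addrK.
  by rewrite /= in_itv/= andbT ltrDr.
rewrite -imE; under [RHS]eq_integral do rewrite subr0.
transitivity (\int[lebesgue_measure]_(x in `]s, +oo[)
    (G (x - s) * (cst 1 : R -> R) x)%:E)%E.
  by apply: eq_integral => x _; rewrite mulr1.
apply/esym; apply: (@ge0_integration_by_substitution_exhaust R (fun x => x - s)
  (cst 1) G (fun n => s + n.+1%:R^-1) (fun n => s + n.+2%:R) `]s, +oo[%classic).
- move=> n; rewrite ltrD2l (@le_lt_trans _ _ 1)// ?ltr1n//.
  by rewrite invf_le1 ?ler1n.
- by move=> m n mn; rewrite lerD2l lef_pV2 ?posrE// ler_nat.
- by move=> m n mn; rewrite lerD2l ler_nat.
- apply/seteqP; split => [x|x [n _]] /=; last first.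
    rewrite !in_itv/= andbT => /andP[+ _]; apply: lt_le_trans.
    by rewrite ltrDl invr_gt0.
  rewrite in_itv/= andbT -subr_gt0 => sx.
  pose n := Num.truncn (Num.max (x - s) (x - s)^-1).
  have : Num.max (x - s) (x - s)^-1 < n.+1%:R by exact: truncnS_gt.
  rewrite gt_max => /andP[x1 x2].
  exists n => //=; rewrite in_itv/=; apply/andP; split.
    by rewrite -lerBrDl -[leRHS]invrK lef_pV2 ?posrE ?invr_gt0// ltW.
  by rewrite -lerBlDl (le_trans (ltW x1))// ler_nat.
- by move=> x y _ _ xy; rewrite ltrD2r.
- by move=> x _; apply: is_derive_eq; rewrite oppr0 addr0.
- by move=> x _; exact: cvg_cst.
- by move=> x _.
- by move=> x; rewrite /= in_itv/= andbT -subr_gt0 => /cG.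
- by move=> x _; rewrite -lee_fin gamma_integrand_ge0.
Unshelve. all: by end_near. Qed.

(** Euler's relation.  In the double integral of
    s^(p-1) u^(q-1) e^(-s-u), put u = v - s and integrate in s first: the
    exponential becomes e^(-v) and the powers convolve to a Beta integral. *)
Lemma egammaM (R : realType) (p q : R) :
  (egamma R p * egamma R q = beta R q p * egamma R (p + q))%E.
Proof.
(* z = (s, v), where v is the sum of the two original variables. *)
pose f (z : R * R) := truncated_power R p z.1 * expR (- z.1) *
  (truncated_power R q (z.2 - z.1) * expR (- (z.2 - z.1))).
have mf : measurable_fun setT f.
  have m1 : measurable_fun [set: R * R] (fun z : R * R => z.1) by exact: measurable_fst.
  have m2 : measurable_fun [set: R * R] (fun z : R * R => z.2 - z.1).
    exact: (measurable_funB measurable_snd measurable_fst).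
  apply: measurable_funM.
    exact: (measurableT_comp (measurable_gamma_integrand R p setT) m1).
  exact: (measurableT_comp (measurable_gamma_integrand R q setT) m2).
have f0 z : (0 <= (f z)%:E)%E.
  by rewrite lee_fin mulr_ge0 // -lee_fin gamma_integrand_ge0.
have := @fubini_tonelli _ _ _ _ R (@lebesgue_measure R) (@lebesgue_measure R)
  (EFin \o f) (proj2 (measurable_EFinP _ _) mf) f0.
have gammaq0 z : (0 <= egamma R z)%E.
  by apply: integral_ge0 => x _; exact: gamma_integrand_ge0.
have -> : (\int[lebesgue_measure]_x \int[lebesgue_measure]_y (EFin \o f) (x, y) =
           egamma R p * egamma R q)%E.
  rewrite muleC -ge0_integralZl//=.
  - apply: eq_integral => x _; rewrite /f/= muleC.
    rewrite -(@egamma_translate R q x) -ge0_integralZl_EFin//.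
    + by move=> y _; exact: gamma_integrand_ge0.
    + apply/measurable_EFinP.
      apply: (measurableT_comp (measurable_gamma_integrand R q setT)).
      exact: measurable_funB.
    + by rewrite -lee_fin gamma_integrand_ge0.
  - by apply/measurable_EFinP; exact: measurable_gamma_integrand.
  - by move=> x _; exact: gamma_integrand_ge0.
move=> ->.
rewrite -ge0_integralZl//=; first last.
- exact: beta_ge0.
- by move=> x _; exact: gamma_integrand_ge0.
- by apply/measurable_EFinP; exact: measurable_gamma_integrand.
apply: eq_integral => v _.
rewrite EFinM muleA [(p + q)%R]addrC -integral_truncated_power_conv muleC.
rewrite -ge0_integralZl_EFin//.
- apply: eq_integral => x _; rewrite /f/= -EFinM; congr EFin.
  have -> : expR (- v) = expR (- x) * expR (- (v - x)).
    by rewrite -expRD; congr expR; ring.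
  by ring.
- by move=> x _; rewrite lee_fin mulr_ge0 ?truncated_power_ge0.
- apply/measurable_EFinP; apply: measurable_funM.
    apply: (measurableT_comp (measurable_truncated_power R q setT)).
    exact: measurable_funB.
  exact: measurable_truncated_power.
Qed.

Lemma GammaE (R : realType) (z : R) : Gamma z = fine (egamma R z).
Proof.
rewrite /Gamma /Rintegral; congr fine.
rewrite -integral_itv_obnd_cbnd; last first.
  apply/measurable_EFinP; apply: measurable_funTS; apply: measurable_funM.
    exact: measurable_powR.
  exact: measurableT_comp.
rewrite integral_mkcond; apply: eq_integral => x _; rewrite patchE.
have [x0|x0] := ltP 0 x.
  by rewrite mem_set ?truncated_power_gt0//= in_itv/= x0.
rewrite truncated_power_le0// mul0r memNset//= in_itv/= andbT.
by apply/negP; rewrite -leNgt.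
Qed.

(** The integrand is bounded below by e^(-2) / 2 on [1, 2], as x^(z-1) is at
    least x^(-1) there. *)
Lemma egamma_gt0 (R : realType) (z : R) : 0 < z -> (0 < egamma R z)%E.
Proof.
move=> z0.
have lb (x : R) : 1 <= x <= 2 ->
    2^-1 * expR (-2) <= truncated_power R z x * expR (- x).
  move=> /andP[x1 x2]; have x0 : 0 < x by exact: lt_le_trans x1.
  rewrite truncated_power_gt0//; apply: ler_pM => //.
  - apply: (@le_trans _ _ (x `^ (-1))).
      by rewrite powR_inv1 ?(ltW x0)// lef_pV2 ?posrE.
    by apply: ler_powR => //; rewrite lerBDr addNr ltW.
  - by rewrite ler_expR lerN2.
apply: (@lt_le_trans _ _ (\int[lebesgue_measure]_(x in `[1%R, 2%R])
    (2^-1 * expR (-2) : R)%:E)%E).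
  rewrite integral_cst//= lebesgue_measure_itv/= lte_fin ltr1n -EFinB -EFinM lte_fin.
  by rewrite !mulr_gt0 ?expR_gt0// ?invr_gt0// subr_gt0 ltr1n.
apply: (@le_trans _ _ (\int[lebesgue_measure]_(x in `[1%R, 2%R])
    (truncated_power R z x * expR (- x))%:E)%E).
  apply: ge0_le_integral => //=.
  - by apply/measurable_EFinP; exact: measurable_gamma_integrand.
apply: ge0_subset_integral => //=.
- by apply/measurable_EFinP; exact: measurable_gamma_integrand.
- by move=> x _; exact: gamma_integrand_ge0.
Qed.

Lemma egamma1 (R : realType) : egamma R 1 = 1%E.
Proof.
transitivity (\int[lebesgue_measure]_(x in `[0%R, +oo[) (expR (- x : R))%:E)%E.
  rewrite -integral_itv_obnd_cbnd; last first.
    by apply/measurable_EFinP; apply: measurable_funTS; apply: measurableT_comp.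
  rewrite [RHS]integral_mkcond; apply: eq_integral => x _; rewrite patchE.
  have [x0|x0] := ltP 0 x.
    by rewrite mem_set ?truncated_power_gt0//= ?in_itv/= ?x0// subrr powRr0 mul1r.
  rewrite truncated_power_le0// mul0r memNset//= in_itv/= andbT.
  by apply/negP; rewrite -leNgt.
have dF (x : R) : is_derive x (1 : R) (fun x : R => - expR (- x)) (expR (- x)).
  by apply: is_derive_eq; rewrite /GRing.scale/=; ring.
have cexp (x : R) : {for x, continuous (fun x : R => expR (- x))}.
  apply: (@continuous_comp _ _ _ (@GRing.opp R) (@expR R)).
    exact: oppr_continuous.
  exact: continuous_expR.
rewrite (@ge0_continuous_FTC2y R _ (fun x => - expR (- x)) 0 0).
- by rewrite oppr0 expR0 -EFinB opprK add0r.
- by move=> x _; exact: expR_ge0.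
- by apply: continuous_subspaceT => x; exact: cexp.
- rewrite -oppr0; apply: cvgN; exact: cvgr_expR.
- by move=> x _; apply: ex_derive; exact: dF.
- by apply: cvg_at_right_filter; apply: cvgN; exact: cexp.
- by move=> x _; rewrite derive1E; apply: derive_val.
Qed.

(** Euler's relation for q = 1, as Gamma(1) = 1 and B(1,z) = 1/z. *)
Lemma egammaS (R : realType) (z : R) : 0 < z ->
  egamma R (z + 1) = (z%:E * egamma R z)%E.
Proof.
move=> z0; have := egammaM R z 1; rewrite egamma1 mule1 => ->.
have -> : beta R 1 z = z^-1%:E.
  rewrite -integral_powR01//; apply: eq_integral => v _.
  by rewrite subrr powRr0 mul1r.
by rewrite muleA -EFinM divff ?gt_eqF// mul1e.
Qed.

Lemma egamma_nat (R : realType) (n : nat) : egamma R n.+1%:R = (n`!%:R)%:E.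
Proof.
elim: n => [|n IHn]; first by rewrite egamma1.
by rewrite -natr1 egammaS// IHn factS natrM EFinM.
Qed.

(** Euler's relation again: for w > 0 with z + w an integer, the product of
    the positive values at z and w is a finite Beta integral times a factorial,
    so neither factor can be infinite. *)
Lemma egamma_fin_num (R : realType) (z : R) : 0 < z -> egamma R z \is a fin_num.
Proof.
move=> z0; pose n := Num.truncn z; pose w := n.+1%:R - z.
have w0 : 0 < w by rewrite subr_gt0 truncnS_gt.
have := egammaM R z w; rewrite /w subrKC egamma_nat -/w => E.
have gz := egamma_gt0 R z z0; have gw := egamma_gt0 R w w0.
have Ef : (egamma R z * egamma R w)%E \is a fin_num.
  by rewrite E fin_numM// beta_fin_num.
rewrite (ge0_fin_numE (ltW gz)) ltey; apply: contraTN Ef => /eqP ->.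
by rewrite gt0_mulye.
Qed.

Lemma Gamma_gt0 (R : realType) (z : R) : 0 < z -> 0 < Gamma z.
Proof.
by move=> z0; rewrite GammaE fine_gt0// egamma_gt0//= ltey_eq egamma_fin_num.
Qed.

Lemma GammaM (R : realType) (p q : R) : 0 < p -> 0 < q ->
  Gamma p * Gamma q = fine (beta R p q) * Gamma (p + q).
Proof.
move=> p0 q0; rewrite (GammaE R p) (GammaE R q) (GammaE R (p + q)).
have fp := egamma_fin_num R p p0; have fq := egamma_fin_num R q q0.
have fpq := egamma_fin_num R (p + q) (addr_gt0 p0 q0).
have fb := beta_fin_num R p q p0 q0.
have fineMM (x y b g : \bar R) : x \is a fin_num -> y \is a fin_num ->
    b \is a fin_num -> g \is a fin_num ->
    (y * x = b * g)%E -> fine x * fine y = fine b * fine g.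
  by move=> ? ? ? ? E; rewrite -!fineM// -E muleC.
have := egammaM R q p; rewrite [(q + p)%R]addrC.
exact: (fineMM _ _ _ _ fp fq fb fpq).
Qed.

Lemma Gamma_nat (R : realType) (n : nat) : Gamma (n.+1%:R : R) = n`!%:R.
Proof. by rewrite GammaE egamma_nat. Qed.

(** * Composition of integral operators with nonnegative kernels *)

Lemma integrable_boundedMr (R : realType) (g y : R -> R) (M : R) :
  lebesgue_measure.-integrable setT (EFin \o g) ->
  measurable_fun setT y -> (forall x, `|y x| <= M) ->
  lebesgue_measure.-integrable setT (fun x => (g x * y x)%:E).
Proof.
move=> ig my yM.
apply: (integrableMl measurableT ig my).
exists M; split; first exact: num_real.
by move=> N MN x _ /=; rewrite (le_trans (yM x))// ltW.
Qed.

(** Fubini's theorem for the composition of the functional with kernel k and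
    the operator with kernel h.  Boundedness of y makes the double integral
    absolutely convergent as soon as the composed kernel r is integrable.
    Integrability of every h s, rather than of almost every one, makes the
    inner real-valued integral meaningful for each s. *)
Lemma Rintegral_kernel_comp (R : realType) (k r y : R -> R) (h : R -> R -> R)
    (M : R) :
  (forall s, 0 <= k s) -> (forall s u, 0 <= h s u) ->
  measurable_fun setT k ->
  measurable_fun setT (fun z : R * R => h z.1 z.2) ->
  measurable_fun setT y -> (forall u, `|y u| <= M) ->
  (forall s, lebesgue_measure.-integrable setT (fun u => (h s u)%:E)) ->
  (forall u, (\int[lebesgue_measure]_s (k s * h s u)%:E = (r u)%:E)%E) ->
  lebesgue_measure.-integrable setT (EFin \o r) ->
  \int[lebesgue_measure]_s (k s * \int[lebesgue_measure]_u (h s u * y u)) =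
  \int[lebesgue_measure]_u (r u * y u).
Proof.
move=> k0 h0 mk mh my yM ih khr ir.
have M0 : 0 <= M by exact: le_trans (normr_ge0 (y 0)) (yM 0).
have r0 u : 0 <= r u.
  rewrite -lee_fin -khr; apply: integral_ge0 => s _.
  by rewrite lee_fin mulr_ge0.
have mk1 : measurable_fun setT (fun z : R * R => k z.1).
  exact: (measurableT_comp mk measurable_fst).
have my2 : measurable_fun setT (fun z : R * R => y z.2).
  exact: (measurableT_comp my measurable_snd).
pose f (z : R * R) : \bar R := (k z.1 * (h z.1 z.2 * y z.2))%:E.
have mf : measurable_fun setT f.
  apply/measurable_EFinP; apply: (measurable_funM mk1).
  exact: (measurable_funM mh my2).
have mkh u : measurable_fun setT (fun s => (k s * h s u)%:E).
  apply/measurable_EFinP; apply: (measurable_funM mk).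
  exact: (measurableT_comp mh (measurable_pair2 u)).
have intf : (lebesgue_measure \x lebesgue_measure)%E.-integrable setT f.
  apply: (proj2 (integrable21ltyP (@lebesgue_measure R) (@lebesgue_measure R) mf)).
  have [_] := integrableP _ _ _ (integrableZl measurableT M ir).
  apply: le_lt_trans; apply: ge0_le_integral => //.
  - by move=> u _; exact: integral_ge0.
  - have maf : measurable_fun setT (abse \o f) by exact: measurableT_comp.
    exact: (@measurable_fun_fubini_tonelli_G _ _ _ _ R (@lebesgue_measure R)
      (abse \o f) maf (fun z => abse_ge0 (f z))).
  - apply: measurableT_comp => //; apply: measurable_funeM.
    exact: measurable_int ir.
  move=> u _.
  have -> : (\int[lebesgue_measure]_x `|f (x, u)| = `|y u|%:E * (r u)%:E)%E.
    have kh0 s : setT s -> (0 <= (k s * h s u)%:E)%E.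
      by move=> _; rewrite lee_fin mulr_ge0.
    have := ge0_integralZl_EFin (@lebesgue_measure R) measurableT kh0 (mkh u)
      (normr_ge0 (y u)).
    rewrite khr => <-.
    apply: eq_integral => s _.
    rewrite /f/= !normrM (ger0_norm (k0 s)) (ger0_norm (h0 s u)).
    by rewrite -EFinM; congr EFin; ring.
  rewrite -!EFinM/= normrM (ger0_norm M0) (ger0_norm (r0 u)) lee_fin.
  exact: ler_wpM2r.
have := Fubini intf.
rewrite /Rintegral => E; congr fine.
have ihy s := integrable_boundedMr R (h s) y M (ih s) my yM.
transitivity (\int[lebesgue_measure]_s \int[lebesgue_measure]_u f (s, u))%E.
  apply: eq_integral => s _; rewrite EFinM fineK; last first.
    exact: integrable_fin_num (ihy s).
  by rewrite -(integralZl measurableT (ihy s) (k s)); apply: eq_integral.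
rewrite E; apply: eq_integral => u _.
have ikh : lebesgue_measure.-integrable setT (fun s => (k s * h s u)%:E).
  apply/integrableP; split; first exact: mkh.
  under eq_integral do rewrite gee0_abs ?lee_fin ?mulr_ge0//.
  by rewrite khr ltry.
rewrite [in RHS]EFinM -khr muleC -(integralZl measurableT ikh (y u)).
by apply: eq_integral => s _; rewrite /f/= -EFinM; congr EFin; ring.
Qed.

(** * Fractional kernels along a change of time *)

Lemma measurable_truncated_power_comp (R : realType) (d : measure_display)
    (T : measurableType d) (p : R) (g : T -> R) :
  measurable_fun setT g -> measurable_fun setT (fun x => truncated_power R p (g x)).
Proof. exact: (measurableT_comp (measurable_truncated_power R p setT)). Qed.

(** P is the new time and w the weight of the integrals; the constant c is kept
    apart because the Katugampola integrals carry the weight s^(rho-1) while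
    (s^rho)' = rho s^(rho-1). *)
Record time_change (R : realType) (a b c : R) (P w : R -> R) : Prop := TimeChange {
  time_change_scale : 0 < c ;
  time_change_incr : {in `[a, b] &, {homo P : x y / x < y}} ;
  time_change_cont : {within `[a, b], continuous P} ;
  time_change_derive :
    {in `]a, b[, forall x : R, is_derive x 1 P (c * w x)} ;
  time_change_cont_weight : {in `]a, b[, continuous w} ;
  time_change_weight_ge0 : forall x, 0 <= w x ;
  time_change_measurable : measurable_fun setT P ;
  time_change_measurable_weight : measurable_fun setT w }.

Lemma integral_time_change_kernel (R : realType) (a b c : R) (P w : R -> R)
    (p q s t : R) :
  time_change R a b c P w -> 0 < p -> 0 < q -> s \in `[a, b] -> t \in `[a, b] ->
  (\int[lebesgue_measure]_(x in `[a, b]) (truncated_power R p (P t - P x) * w x *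
     truncated_power R q (P x - P s))%:E =
   (fine (beta R p q) / c * truncated_power R (p + q) (P t - P s))%:E)%E.
Proof.
move=> [c0 incP cP derP cw w0 mP mw] p0 q0 sab tab.
have st_sub : `[s, t]%classic `<=` `[a, b]%classic.
  by apply: subset_itvScc; rewrite bnd_simp;
    [move: sab|move: tab]; rewrite in_itv/= => /andP[].
have st_subo : {subset `]s, t[ <= `]a, b[}.
  apply: subset_itvSoo; rewrite bnd_simp;
    [move: sab|move: tab]; by rewrite in_itv/= => /andP[].
have := @integral_truncated_powerM R p q P (fun x => c * w x) `[a, b]%classic s t
  sab tab st_sub.
have incP' : {in `[a, b]%classic &, {homo P : x y / x < y}}.
  by move=> x y /set_mem xab /set_mem yab; exact: incP.
have cPst := continuous_subspaceW st_sub cP.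
have derPst : {in `]s, t[, forall x : R, is_derive x 1 P (c * w x)}.
  by move=> x /st_subo; exact: derP.
have cwst : {in `]s, t[, continuous (fun x => c * w x)}.
  by move=> x /st_subo xab; apply: cvgM; [exact: cvg_cst|exact: cw].
have w0st : {in `]s, t[, forall x, 0 <= c * w x}.
  by move=> x _; rewrite mulr_ge0// ltW.
move=> /(_ incP' cPst derPst cwst w0st) H.
set f := (fun x : R => (truncated_power R p (P t - P x) * w x *
     truncated_power R q (P x - P s))%:E).
have f0 x : (0 <= f x)%E.
  rewrite lee_fin; apply: mulr_ge0; last exact: truncated_power_ge0.
  by apply: mulr_ge0; [exact: truncated_power_ge0|exact: w0].
have mf : measurable_fun (`[a, b]%classic : set R) f.
  apply/measurable_EFinP; apply: measurable_funTS.
  have mPt := measurable_truncated_power_comp R _ _ p _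
    (measurable_funB (@measurable_cst _ _ _ R setT (P t)) mP).
  have mPs := measurable_truncated_power_comp R _ _ q _
    (measurable_funB mP (@measurable_cst _ _ _ R setT (P s))).
  exact: (measurable_funM (measurable_funM mPt mw) mPs).
have E : (c%:E * \int[lebesgue_measure]_(x in `[a, b]) f x =
    beta R p q * (truncated_power R (p + q) (P t - P s))%:E)%E.
  rewrite -H -ge0_integralZl_EFin//; last exact: ltW.
  by apply: eq_integral => x _; rewrite /f -EFinM; congr EFin; ring.
have -> : (\int[lebesgue_measure]_(x in `[a, b]) f x =
    (c^-1)%:E * (c%:E * \int[lebesgue_measure]_(x in `[a, b]) f x))%E.
  by rewrite muleA -EFinM mulVf ?gt_eqF// mul1e.
rewrite E -[beta R p q in LHS](fineK (beta_fin_num R p q p0 q0)) -!EFinM.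
by congr EFin; ring.
Qed.

(** The right-hand side is symmetric in p and q, unlike the integral; this
    symmetry lets left and right kernels share one composition formula. *)
Lemma fine_beta (R : realType) (p q : R) : 0 < p -> 0 < q ->
  fine (beta R p q) = Gamma p * Gamma q / Gamma (p + q).
Proof.
by move=> p0 q0; rewrite GammaM// mulfK// gt_eqF// Gamma_gt0// addr_gt0.
Qed.

(** The properties common to the left kernels, with d t s = P t - P s, and to
    the right kernels, with d t s = P s - P t.  The base point u (an endpoint of
    [a, b]) makes the truncated power of order 1 of d s u equal to 1
    for s in ]a, b[, which turns kernel_comp into a computation of the total
    mass of a kernel. *)
Record kernel_semigroup (R : realType) (a b c : R) (d : R -> R -> R)
    (w : R -> R) : Prop := KernelSemigroup {
  kernel_weight_ge0 : forall x, 0 <= w x ;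
  kernel_measurable_weight : measurable_fun setT w ;
  kernel_measurable_diff : measurable_fun setT (fun z : R * R => d z.1 z.2) ;
  kernel_base : exists2 u, u \in `[a, b] & {in `]a, b[, forall s, 0 < d s u} ;
  kernel_comp : forall p q t u, 0 < p -> 0 < q -> t \in `[a, b] -> u \in `[a, b] ->
    (\int[lebesgue_measure]_(s in `[a, b])
      (truncated_power R p (d t s) * w s * truncated_power R q (d s u))%:E =
     (Gamma p * Gamma q / Gamma (p + q) / c *
      truncated_power R (p + q) (d t u))%:E)%E }.

Lemma kernel_semigroup_left (R : realType) (a b c : R) (P w : R -> R) :
  a < b -> time_change R a b c P w ->
  kernel_semigroup R a b c (fun t s => P t - P s) w.
Proof.
move=> ab tc; have [c0 incP cP derP cw w0 mP mw] := tc; split => //.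
- apply: measurable_funB; first exact: (measurableT_comp mP measurable_fst).
  exact: (measurableT_comp mP measurable_snd).
- have aab : a \in `[a, b] by rewrite in_itv/= lexx ltW.
  exists a => // s sab; have := sab; rewrite in_itv/= => /andP[as_ _].
  by rewrite subr_gt0 incP//; exact: subset_itv_oo_cc sab.
- move=> p q t u p0 q0 tab uab.
  by rewrite (integral_time_change_kernel R a b c P w p q u t tc)// fine_beta.
Qed.

(** Exchanging the orders p and q, and the two outer points, turns the
    composition of right kernels into that of left ones. *)
Lemma kernel_semigroup_right (R : realType) (a b c : R) (P w : R -> R) :
  a < b -> time_change R a b c P w ->
  kernel_semigroup R a b c (fun t s => P s - P t) w.
Proof.
move=> ab tc; have [c0 incP cP derP cw w0 mP mw] := tc; split => //.
- apply: measurable_funB; first exact: (measurableT_comp mP measurable_snd).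
  exact: (measurableT_comp mP measurable_fst).
- have bab : b \in `[a, b] by rewrite in_itv/= lexx ltW.
  exists b => // s sab; have := sab; rewrite in_itv/= => /andP[_ sb].
  by rewrite subr_gt0 incP//; exact: subset_itv_oo_cc sab.
- move=> p q t u p0 q0 tab uab.
  have := integral_time_change_kernel R a b c P w q p t u tc q0 p0 tab uab.
  rewrite fine_beta// [(q + p)%R]addrC [(Gamma q * _)%R]mulrC => <-.
  by apply: eq_integral => s _; congr EFin; rewrite -mulrA mulrC [w s * _]mulrC.
Qed.

Definition kernel_operator (R : realType) (a b : R) (d : R -> R -> R)
    (w : R -> R) (p : R) (y : R -> R) (t : R) : R :=
  \int[lebesgue_measure]_(s in `[a, b]) (truncated_power R p (d t s) * w s * y s).

Lemma measurable_kernel (R : realType) (a b c : R) (d : R -> R -> R)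
    (w : R -> R) (p t : R) : kernel_semigroup R a b c d w ->
  measurable_fun setT (fun s => truncated_power R p (d t s) * w s).
Proof.
move=> [w0 mw md _ _]; apply: measurable_funM => //.
apply: measurable_truncated_power_comp.
exact: (measurableT_comp md (measurable_pair1 t)).
Qed.

Lemma kernel_ge0 (R : realType) (a b c : R) (d : R -> R -> R)
    (w : R -> R) (p t s : R) : kernel_semigroup R a b c d w ->
  0 <= truncated_power R p (d t s) * w s.
Proof.
by move=> [w0 _ _ _ _]; apply: mulr_ge0 => //; exact: truncated_power_ge0.
Qed.

(** Composing with the kernel of order 1 based at the endpoint u changes nothing
    inside ]a, b[, and gives a finite value. *)
Lemma integrable_kernel (R : realType) (a b c : R) (d : R -> R -> R)
    (w : R -> R) (p t : R) : kernel_semigroup R a b c d w ->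
  0 < p -> t \in `[a, b] ->
  lebesgue_measure.-integrable `[a, b]
    (fun s => (truncated_power R p (d t s) * w s)%:E).
Proof.
move=> kd p0 tab; have mk := measurable_kernel R a b c d w p t kd.
have [w0 mw md [u uab d0] comp] := kd.
apply/integrableP; split; first by apply/measurable_EFinP; exact: measurable_funTS.
under eq_integral do rewrite gee0_abs ?lee_fin ?(kernel_ge0 R a b c d w p t _ kd)//.
have := comp p 1 t u p0 ltr01 tab uab.
have mk' : measurable_fun setT
    (fun s => (truncated_power R p (d t s) * w s)%:E) by exact/measurable_EFinP.
have mk1 : measurable_fun setT (fun s : R =>
    (truncated_power R p (d t s) * w s * truncated_power R 1 (d s u))%:E).
  apply/measurable_EFinP; apply: measurable_funM => //.
  apply: measurable_truncated_power_comp.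
  exact: (measurableT_comp md (measurable_pair2 u)).
rewrite (integral_itv_bndoo _ _ (measurable_funTS mk1)) => E.
rewrite (integral_itv_bndoo _ _ (measurable_funTS mk')).
rewrite (_ : integral _ _ _ = (Gamma p * Gamma 1 / Gamma (p + 1) / c *
      truncated_power R (p + 1) (d t u))%:E) ?ltry//.
rewrite -E; apply: eq_integral => s /set_mem sab.
by rewrite [truncated_power R 1 _]truncated_power_gt0 ?d0// subrr powRr0 mulr1.
Qed.

Lemma integrable_kernelM (R : realType) (a b c M : R) (d : R -> R -> R)
    (w : R -> R) (p t : R) (y : R -> R) : kernel_semigroup R a b c d w ->
  0 < p -> t \in `[a, b] ->
  measurable_fun `[a, b] y -> (forall x, x \in `[a, b] -> `|y x| <= M) ->
  lebesgue_measure.-integrable `[a, b]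
    (fun s => (truncated_power R p (d t s) * w s * y s)%:E).
Proof.
move=> kd p0 tab my yM.
apply: (integrableMl _ (integrable_kernel R a b c d w p t kd p0 tab) my) => //.
exists M; split; first exact: num_real.
by move=> N MN x xab /=; rewrite (le_trans (yM x xab))// ltW.
Qed.

Lemma kernel_operatorZ (R : realType) (a b c M : R) (d : R -> R -> R)
    (w : R -> R) (p t k : R) (y : R -> R) : kernel_semigroup R a b c d w ->
  0 < p -> t \in `[a, b] ->
  measurable_fun `[a, b] y -> (forall x, x \in `[a, b] -> `|y x| <= M) ->
  kernel_operator R a b d w p (fun s => k * y s) t =
  k * kernel_operator R a b d w p y t.
Proof.
move=> kd p0 tab my yM; rewrite /kernel_operator -RintegralZl//.
  by apply: eq_Rintegral => s _; ring.
exact: (integrable_kernelM R a b c M d w p t y).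
Qed.

(** The weight and the domain are moved into the kernels by indicators, so that
    the composition theorem on the whole line applies. *)
Lemma kernel_operator_comp (R : realType) (a b c M : R) (d : R -> R -> R)
    (w : R -> R) (p q t : R) (y : R -> R) : kernel_semigroup R a b c d w ->
  0 < p -> 0 < q -> t \in `[a, b] ->
  measurable_fun `[a, b] y -> (forall x, x \in `[a, b] -> `|y x| <= M) ->
  kernel_operator R a b d w p (kernel_operator R a b d w q y) t =
  Gamma p * Gamma q / Gamma (p + q) / c * kernel_operator R a b d w (p + q) y t.
Proof.
move=> kd p0 q0 tab my yM; have pq0 := addr_gt0 p0 q0.
have [w0 mw md _ comp] := kd.
set C := Gamma p * Gamma q / Gamma (p + q) / c.
pose D : set R := `[a, b]%classic; pose iD : R -> R := \1_D.
have iD1 s : s \in `[a, b] -> iD s = 1 by move=> sab; rewrite /iD indicE mem_set.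
have iD0 s : s \notin `[a, b] -> iD s = 0.
  by move=> /negP sab; rewrite /iD indicE memNset.
have iDge0 s : 0 <= iD s by [].
have miD : measurable_fun setT iD by apply: measurable_indic; exact: measurable_itv.
pose k s := iD s * (truncated_power R p (d t s) * w s).
pose h s u := iD s * (truncated_power R q (d s u) * (iD u * w u)).
pose r u := C * (iD u * (truncated_power R (p + q) (d t u) * w u)).
pose y0 := y \_ D.
have my0 : measurable_fun setT y0.
  exact: (proj1 (measurable_restrictT y (measurable_itv `[a, b])) my).
have y0M u : `|y0 u| <= `|M|.
  rewrite /y0 patchE; case: ifPn => [/set_mem uab|_]; last by rewrite normr0.
  exact: le_trans (yM _ uab) (ler_norm _).
have k0 s : 0 <= k s by apply: mulr_ge0 => //; exact: (kernel_ge0 R a b c d w _ _ _ kd).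
have h0 s u : 0 <= h s u.
  apply: mulr_ge0 => //; apply: mulr_ge0; first exact: truncated_power_ge0.
  exact: mulr_ge0.
have mk : measurable_fun setT k.
  exact: (measurable_funM miD (measurable_kernel R a b c d w p t kd)).
have mh : measurable_fun setT (fun z : R * R => h z.1 z.2).
  apply: measurable_funM; first exact: (measurableT_comp miD measurable_fst).
  apply: measurable_funM; first exact: measurable_truncated_power_comp.
  apply: measurable_funM; first exact: (measurableT_comp miD measurable_snd).
  exact: (measurableT_comp mw measurable_snd).
have patchK (g : R -> R) : lebesgue_measure.-integrable D (fun u => (g u)%:E) ->
    lebesgue_measure.-integrable setT (fun u => (iD u * g u)%:E).
  move=> ig; have := proj1 (@integrable_mkcond _ _ R (@lebesgue_measure R) D
    (fun u => (g u)%:E) (measurable_itv `[a, b])) ig.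
  apply: eq_integrable => // u _; rewrite patchE; case: ifPn => [/set_mem uab|].
    by rewrite iD1 ?mul1r.
  by move=> /negP uab; rewrite iD0 ?mul0r//; apply/negP => ?; apply/uab/mem_set.
have ih s : lebesgue_measure.-integrable setT (fun u => (h s u)%:E).
  have [sab|sab] := boolP (s \in `[a, b]); last first.
    apply: eq_integrable (integrable0 _ _) => // u _.
    by rewrite /h (iD0 s sab) mul0r.
  apply: eq_integrable (patchK _ (integrable_kernel R a b c d w q s kd q0 sab)) => //.
  by move=> u _; rewrite /h (iD1 s sab) mul1r; congr EFin; rewrite mulrCA.
have khr u : (\int[lebesgue_measure]_s (k s * h s u)%:E = (r u)%:E)%E.
  have [uab|uab] := boolP (u \in `[a, b]); last first.
    rewrite /r iD0// mul0r mulr0; apply: integral0_eq => s _.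
    by rewrite /h (iD0 u uab) mul0r !mulr0.
  have := comp p q t u p0 q0 tab uab; rewrite -/C => E.
  rewrite /r iD1// mul1r mulrA EFinM -E muleC.
  have mkq : measurable_fun D (fun s : R =>
      (truncated_power R p (d t s) * w s * truncated_power R q (d s u))%:E).
    apply/measurable_EFinP; apply: measurable_funTS; apply: measurable_funM.
      exact: (measurable_kernel R a b c d w _ _ kd).
    apply: measurable_truncated_power_comp.
    exact: (measurableT_comp md (measurable_pair2 u)).
  have kq0 s : D s ->
      (0 <= (truncated_power R p (d t s) * w s * truncated_power R q (d s u))%:E)%E.
    move=> _; rewrite lee_fin; apply: mulr_ge0; last exact: truncated_power_ge0.
    exact: (kernel_ge0 R a b c d w _ _ _ kd).
  have := ge0_integralZl_EFin (@lebesgue_measure R) (measurable_itv `[a, b]) kq0 mkq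
    (w0 u).
  move=> <-; rewrite [RHS]integral_mkcond; apply: eq_integral => s _.
  rewrite patchE; case: ifPn => [/set_mem sab|/negP sab].
    by rewrite /k /h !iD1// -EFinM; congr EFin; ring.
  by rewrite /k iD0 ?mul0r//; apply/negP => ?; apply/sab/mem_set.
have ir : lebesgue_measure.-integrable setT (EFin \o r).
  exact: (integrableZl measurableT C
    (patchK _ (integrable_kernel R a b c d w (p + q) t kd pq0 tab))).
transitivity (\int[lebesgue_measure]_s
    (k s * \int[lebesgue_measure]_u (h s u * y0 u))).
  rewrite /kernel_operator Rintegral_mkcond; apply: eq_Rintegral => s _.
  rewrite patchE; case: ifPn => [/set_mem sab|/negP sab].
    rewrite /k iD1// mul1r Rintegral_mkcond; congr (_ * _).
    apply: eq_Rintegral => u _; rewrite /h (iD1 s sab) mul1r /y0 !patchE.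
    by case: ifPn => [/set_mem uab|_]; rewrite ?mulr0// iD1// mul1r.
  by rewrite /k iD0 ?mul0r//; apply/negP => ?; apply/sab/mem_set.
rewrite (Rintegral_kernel_comp R k r y0 h _ k0 h0 mk mh my0 y0M ih khr ir).
rewrite -(kernel_operatorZ R a b c M d w (p + q) t C y kd pq0 tab my yM).
rewrite /kernel_operator [RHS]Rintegral_mkcond; apply: eq_Rintegral => u _.
rewrite /r /y0 !patchE; case: ifPn => [/set_mem uab|_]; last by rewrite mulr0.
by rewrite iD1//; ring.
Qed.

(** * The semigroup property of the Katugampola integrals *)

Lemma time_change_powR (R : realType) (a b rho : R) : 0 < a -> 0 < rho ->
  time_change R a b rho (@powR R ^~ rho) (@powR R ^~ (rho - 1)).
Proof.
move=> a0 rho0.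
have pos (x : R) : x \in `[a, b] -> 0 < x.
  by rewrite in_itv/= => /andP[+ _]; exact: lt_le_trans.
have poso (x : R) : x \in `]a, b[ -> 0 < x.
  by move=> xab; apply: pos; exact: subset_itv_oo_cc xab.
split => //.
- move=> x y /pos x0 /pos y0 xy.
  by apply: gt0_ltr_powR => //; rewrite nnegrE ltW.
- apply: continuous_in_subspaceT => x /set_mem xab.
  by apply: continuous_powR; exact: pos.
- by move=> x /poso; exact: is_derive_powR.
- by move=> x /poso; exact: continuous_powR.
- by move=> x; exact: powR_ge0.
Qed.

(** At 0 the two sides agree unless p = 1, where they are 0 and 1. *)
Lemma truncated_power_powR (R : realType) (p x : R) : p != 1 -> 0 <= x ->
  truncated_power R p x = x `^ (p - 1).
Proof.
move=> p1; rewrite le_eqVlt => /predU1P[<-|]; last exact: truncated_power_gt0.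
by rewrite truncated_power_le0// powR0// subr_eq0.
Qed.

Lemma powR_diff_itv (R : realType) (a b rho s t : R) : 0 < a -> 0 < rho ->
  s \in `[a, b] -> t \in `[a, b] -> (0 <= t `^ rho - s `^ rho) = (s <= t).
Proof.
move=> a0 rho0; rewrite !in_itv/= => /andP[as_ _] /andP[at_ _].
have s0 := lt_le_trans a0 as_; have t0 := lt_le_trans a0 at_.
rewrite subr_ge0; apply/idP/idP => [|st]; last first.
  by apply: ge0_ler_powR; rewrite ?nnegrE ?(ltW rho0) ?(ltW s0) ?(ltW t0).
apply: contraTT; rewrite -!ltNge => ts.
by apply: gt0_ltr_powR => //; rewrite nnegrE ltW.
Qed.

(** Points beyond t contribute nothing, so the upper limit t can be replaced by
    the fixed endpoint b. *)
Lemma kat_int_leftE (R : realType) (a b rho p t : R) (y : R -> R) :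
  0 < a -> 0 < rho -> p != 1 -> t \in `[a, b] ->
  kat_int_left a p rho y t = rho `^ (1 - p) / Gamma p *
    kernel_operator R a b (fun t s => t `^ rho - s `^ rho) (@powR R ^~ (rho - 1))
      p y t.
Proof.
move=> a0 rho0 p1 tab; rewrite /kat_int_left /kernel_operator.
apply: (congr1 (fun z => rho `^ (1 - p) / Gamma p * z)).
rewrite Rintegral_mkcond [RHS]Rintegral_mkcond; apply: eq_Rintegral => s _.
have [/andP[as_ tb]] : a <= t <= b /\ true by move: tab; rewrite in_itv.
move=> _; rewrite !patchE.
have [sab|sab] := boolP (s \in `[a, b]); last first.
  rewrite [in RHS]ifF; last by apply/negP => /set_mem; exact/negP.
  rewrite ifF//; apply/negP => /set_mem /=; rewrite in_itv/= => /andP[as' st].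
  by move/negP: sab; apply; rewrite in_itv/= as' (le_trans st).
rewrite [in RHS]ifT; last exact/mem_set.
have E := powR_diff_itv R a b rho s t a0 rho0 sab tab.
have [st|ts] := leP s t.
  rewrite ifT; last first.
    by apply/mem_set; move: sab; rewrite /= !in_itv/= st => /andP[->].
  rewrite truncated_power_powR// ?E//; congr (_ * _).
  exact: mulrC.
rewrite ifF; last first.
  by apply/negP => /set_mem; rewrite /= in_itv/= => /andP[_]; rewrite leNgt ts.
by rewrite truncated_power_le0 ?mul0r// ltW// ltNge E -ltNge.
Qed.

Lemma kat_int_rightE (R : realType) (a b rho p t : R) (y : R -> R) :
  0 < a -> 0 < rho -> p != 1 -> t \in `[a, b] ->
  kat_int_right b p rho y t = rho `^ (1 - p) / Gamma p *
    kernel_operator R a b (fun t s => s `^ rho - t `^ rho) (@powR R ^~ (rho - 1))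
      p y t.
Proof.
move=> a0 rho0 p1 tab; rewrite /kat_int_right /kernel_operator.
apply: (congr1 (fun z => rho `^ (1 - p) / Gamma p * z)).
rewrite Rintegral_mkcond [RHS]Rintegral_mkcond; apply: eq_Rintegral => s _.
have [/andP[at_ tb]] : a <= t <= b /\ true by move: tab; rewrite in_itv.
move=> _; rewrite !patchE.
have [sab|sab] := boolP (s \in `[a, b]); last first.
  rewrite [in RHS]ifF; last by apply/negP => /set_mem; exact/negP.
  rewrite ifF//; apply/negP => /set_mem /=; rewrite in_itv/= => /andP[ts sb].
  by move/negP: sab; apply; rewrite in_itv/= sb (le_trans at_).
rewrite [in RHS]ifT; last exact/mem_set.
have E := powR_diff_itv R a b rho t s a0 rho0 tab sab.
have [ts|st] := leP t s.
  rewrite ifT; last first.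
    by apply/mem_set; move: sab; rewrite /= !in_itv/= ts => /andP[_ ->].
  rewrite truncated_power_powR// ?E//; congr (_ * _).
  exact: mulrC.
rewrite ifF; last first.
  by apply/negP => /set_mem; rewrite /= in_itv/= leNgt st.
by rewrite truncated_power_le0 ?mul0r// ltW// ltNge E -ltNge.
Qed.

(** The factor 1 / rho produced by the composition is absorbed by the powers of
    rho that normalize the integrals. *)
Lemma kat_constantM (R : realType) (rho p q : R) : 0 < rho -> 0 < p -> 0 < q ->
  rho `^ (1 - p) / Gamma p * (Gamma p * Gamma q / Gamma (p + q) / rho *
    (rho `^ (1 - q) / Gamma q)) = rho `^ (1 - (p + q)) / Gamma (p + q).
Proof.
move=> rho0 p0 q0; have rho1 : rho != 0 by rewrite gt_eqF.
have E : rho `^ (1 - (p + q)) = rho `^ (1 - p) * (rho `^ (1 - q) / rho).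
  have -> : 1 - (p + q) = (1 - p) + ((1 - q) + (-1)) by ring.
  rewrite (@powRD _ rho (1 - p)) ?rho1 ?implybT//.
  by rewrite (@powRD _ rho (1 - q)) ?rho1 ?implybT// powR_inv1// ltW.
have simplify (A B C r u v : R) : A != 0 -> B != 0 -> C != 0 -> r != 0 ->
    u / A * (A * B / C / r * (v / B)) = u * (v / r) / C.
  by move=> A0 B0 C0 r0; field; rewrite A0 B0 C0 r0.
have neq0 z : 0 < z -> Gamma z != 0 by move=> z0; rewrite gt_eqF// Gamma_gt0.
rewrite E; apply: simplify rho1; [exact: neq0|exact: neq0|].
by apply: neq0; exact: addr_gt0.
Qed.

(** The constant of the inner integral is moved onto y, because there
    boundedness of y ensures integrability. *)
Lemma kat_int_left_comp (R : realType) (a b rho p q t M : R) (y : R -> R) :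
  0 < a -> a < b -> 0 < rho -> 0 < p -> 0 < q -> p != 1 -> q != 1 ->
  t \in `[a, b] ->
  measurable_fun `[a, b] y -> (forall x, x \in `[a, b] -> `|y x| <= M) ->
  kat_int_left a p rho (kat_int_left a q rho y) t =
  rho `^ (1 - (p + q)) / Gamma (p + q) *
    kernel_operator R a b (fun t s => t `^ rho - s `^ rho) (@powR R ^~ (rho - 1))
      (p + q) y t.
Proof.
move=> a0 ab rho0 p0 q0 p1 q1 tab my yM.
have ks := kernel_semigroup_left R a b rho _ _ ab (time_change_powR R a b rho a0 rho0).
set d := (fun t s : R => t `^ rho - s `^ rho) in ks *.
set w := (@powR R ^~ (rho - 1)) in ks *.
set c := rho `^ (1 - q) / Gamma q.
rewrite (kat_int_leftE R a b)// -/d -/w.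
have cyM x : x \in `[a, b] -> `|c * y x| <= `|c| * M.
  by move=> /yM yxM; rewrite normrM ler_wpM2l.
have mcy : measurable_fun `[a, b] (fun x => c * y x).
  exact: (measurable_funM (measurable_cst _) my).
have := kernel_operator_comp R a b rho _ d w p q t _ ks p0 q0 tab mcy cyM.
rewrite (kernel_operatorZ R a b rho M d w _ t c y ks (addr_gt0 p0 q0) tab my yM).
have -> : kernel_operator R a b d w p (kernel_operator R a b d w q (fun x => c * y x)) t
    = kernel_operator R a b d w p (kat_int_left a q rho y) t.
  rewrite /kernel_operator; apply: eq_Rintegral => s /set_mem sab; congr (_ * _).
  rewrite (kat_int_leftE R a b)// -/d -/w.
  exact: (kernel_operatorZ R a b rho M d w q s c y ks q0 sab my yM).
move=> ->; have := kat_constantM R rho p q rho0 p0 q0; rewrite -/c => <-.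
by move: (kernel_operator _ _ _ _ _ _ _ _) => K; rewrite -(mulrA _ _ K) -(mulrA _ c K).
Qed.

Lemma kat_int_right_comp (R : realType) (a b rho p q t M : R) (y : R -> R) :
  0 < a -> a < b -> 0 < rho -> 0 < p -> 0 < q -> p != 1 -> q != 1 ->
  t \in `[a, b] ->
  measurable_fun `[a, b] y -> (forall x, x \in `[a, b] -> `|y x| <= M) ->
  kat_int_right b p rho (kat_int_right b q rho y) t =
  rho `^ (1 - (p + q)) / Gamma (p + q) *
    kernel_operator R a b (fun t s => s `^ rho - t `^ rho) (@powR R ^~ (rho - 1))
      (p + q) y t.
Proof.
move=> a0 ab rho0 p0 q0 p1 q1 tab my yM.
have ks := kernel_semigroup_right R a b rho _ _ ab (time_change_powR R a b rho a0 rho0).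
set d := (fun t s : R => s `^ rho - t `^ rho) in ks *.
set w := (@powR R ^~ (rho - 1)) in ks *.
set c := rho `^ (1 - q) / Gamma q.
rewrite (kat_int_rightE R a b)// -/d -/w.
have cyM x : x \in `[a, b] -> `|c * y x| <= `|c| * M.
  by move=> /yM yxM; rewrite normrM ler_wpM2l.
have mcy : measurable_fun `[a, b] (fun x => c * y x).
  exact: (measurable_funM (measurable_cst _) my).
have := kernel_operator_comp R a b rho _ d w p q t _ ks p0 q0 tab mcy cyM.
rewrite (kernel_operatorZ R a b rho M d w _ t c y ks (addr_gt0 p0 q0) tab my yM).
have -> : kernel_operator R a b d w p (kernel_operator R a b d w q (fun x => c * y x)) t
    = kernel_operator R a b d w p (kat_int_right b q rho y) t.
  rewrite /kernel_operator; apply: eq_Rintegral => s /set_mem sab; congr (_ * _).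
  rewrite (kat_int_rightE R a b)// -/d -/w.
  exact: (kernel_operatorZ R a b rho M d w q s c y ks q0 sab my yM).
move=> ->; have := kat_constantM R rho p q rho0 p0 q0; rewrite -/c => <-.
by move: (kernel_operator _ _ _ _ _ _ _ _) => K; rewrite -(mulrA _ _ K) -(mulrA _ c K).
Qed.

(** * Calculus of one-sided derivatives on a segment *)

Definition has_derive_itv (R : realType) (a b : R) (f g : R -> R) : Prop :=
  forall t, t \in `[a, b] -> diff_quot_at a b f t --> g t.

(** Class C^n with a witness for each derivative.  A witness only has to be
    right on [a, b], and stability under products with powers follows by a
    direct induction. *)
Fixpoint cont_diff_itv (R : realType) (a b : R) (n : nat) (f : R -> R) : Prop :=
  if n is m.+1 then
    exists g, has_derive_itv R a b f g /\ cont_diff_itv R a b m g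
  else {within `[a, b], continuous f}.

Lemma near_dnbhs_itv (R : realType) (a b t : R) :
  \forall s \near within `[a, b] t^', s \in `[a, b] /\ s != t.
Proof.
have H : nbhs t (fun s : R => s != t -> s \in `[a, b] -> s \in `[a, b] /\ s != t).
  by apply: filterE.
exact: H.
Qed.

(** This is what makes the limit of difference quotients unique, also at the
    endpoints. *)
Lemma dnbhs_itv_proper (R : realType) (a b t : R) : a < b -> t \in `[a, b] ->
  ProperFilter (within `[a, b] t^').
Proof.
move=> ab tab; split; last exact: within_filter.
rewrite /within/= => /nbhs_ballP[e /= e0 H].
have [tb|bt] := ltP t b.
  pose s := t + Num.min (e / 2) (b - t).
  have m0 : 0 < Num.min (e / 2) (b - t) by rewrite lt_min divr_gt0// subr_gt0.
  apply: (H s); rewrite /ball/= /s.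
  - rewrite opprD addNKr normrN gtr0_norm// gt_min; apply/orP; left.
    by rewrite ltr_pdivrMr// ltr_pMr// ltr1n.
  - by rewrite gt_eqF// ltrDl.
  - move: tab; rewrite !in_itv/= => /andP[at_ _].
    apply/andP; split; first by rewrite (le_trans at_)// lerDl ltW.
    by rewrite -lerBrDl ge_min lexx orbT.
have at_ : a < t by exact: lt_le_trans ab bt.
pose s := t - Num.min (e / 2) (t - a).
have m0 : 0 < Num.min (e / 2) (t - a) by rewrite lt_min divr_gt0// subr_gt0.
apply: (H s); rewrite /ball/= /s.
- rewrite opprB addrC subrK gtr0_norm// gt_min; apply/orP; left.
  by rewrite ltr_pdivrMr// ltr_pMr// ltr1n.
- by rewrite lt_eqF// ltrBlDr ltrDl.
- move: tab; rewrite !in_itv/= => /andP[_ tb].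
  apply/andP; split; last by rewrite (le_trans _ tb)// gerBl ltW.
  by rewrite lerBrDr -lerBrDl ge_min lexx orbT.
Qed.

Lemma derive_itvE (R : realType) (a b : R) (f g : R -> R) (t : R) : a < b ->
  has_derive_itv R a b f g -> t \in `[a, b] -> derive_itv a b f t = g t.
Proof.
move=> ab fg tab; have := dnbhs_itv_proper R a b t ab tab => ?.
by apply: cvg_lim => //; exact: fg.
Qed.

Lemma has_derive_itv_eq (R : realType) (a b : R) (f1 f2 g1 g2 : R -> R) :
  {in `[a, b], f1 =1 f2} -> {in `[a, b], g1 =1 g2} ->
  has_derive_itv R a b f1 g1 -> has_derive_itv R a b f2 g2.
Proof.
move=> ef eg fg t tab; rewrite -eg//.
apply: cvg_trans (fg t tab); apply: near_eq_cvg.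
near=> s; have [sab _] : s \in `[a, b] /\ s != t.
  by near: s; exact: near_dnbhs_itv.
by rewrite !ef.
Unshelve. all: by end_near. Qed.

Lemma has_derive_itv_cvg (R : realType) (a b : R) (f g : R -> R) (t : R) :
  has_derive_itv R a b f g -> t \in `[a, b] ->
  f s @[s --> within `[a, b] t^'] --> f t.
Proof.
move=> fg tab.
have wt : within `[a, b] t^' `=>` nbhs t.
  move=> A At.
  have H : nbhs t (fun s : R => s != t -> s \in `[a, b] -> A s).
    by apply: filterS At => s As _ _.
  exact: H.
have ct : (fun s : R => s - t) s @[s --> t] --> 0.
  by rewrite -(subrr t); apply: cvgB; [exact: cvg_id|exact: cvg_cst].
have idt : (fun s : R => s - t) s @[s --> within `[a, b] t^'] --> 0.
  exact: cvg_trans (cvg_app _ wt) ct.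
have : (fun s => f t + (f s - f t) / (s - t) * (s - t)) s
    @[s --> within `[a, b] t^'] --> f t + g t * 0.
  by apply: cvgD; [exact: cvg_cst|apply: cvgM => //; exact: fg].
rewrite mulr0 addr0; apply: cvg_trans; apply: near_eq_cvg.
near=> s; have [_ st] : s \in `[a, b] /\ s != t.
  by near: s; exact: near_dnbhs_itv.
by rewrite divfK ?subr_eq0// addrC subrK.
Unshelve. all: by end_near. Qed.

Lemma has_derive_itv_continuous (R : realType) (a b : R) (f g : R -> R) :
  has_derive_itv R a b f g -> {within `[a, b], continuous f}.
Proof.
move=> fg; apply/subspace_continuousP => t tab.
apply/cvgrPdist_le => e e0.
have /cvgrPdist_le/(_ e e0) H := has_derive_itv_cvg R a b f g t fg tab.
have H' : nbhs t (fun s : R => s != t -> s \in `[a, b] -> `|f t - f s| <= e).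
  exact: H.
have : nbhs t (fun s : R => s \in `[a, b] -> `|f t - f s| <= e).
  apply: filterS H' => s H' sab.
  by have [->|st] := eqVneq s t; [rewrite subrr normr0 ltW|exact: H'].
exact.
Qed.

Lemma has_derive_itvD (R : realType) (a b : R) (f1 f2 g1 g2 : R -> R) :
  has_derive_itv R a b f1 g1 -> has_derive_itv R a b f2 g2 ->
  has_derive_itv R a b (fun x => f1 x + f2 x) (fun x => g1 x + g2 x).
Proof.
move=> fg1 fg2 t tab; apply: cvg_trans (cvgD (fg1 t tab) (fg2 t tab)).
by apply: near_eq_cvg; near=> s; rewrite !fctE -mulrDl; congr (_ / _); ring.
Unshelve. all: by end_near. Qed.

Lemma has_derive_itvM (R : realType) (a b : R) (f1 f2 g1 g2 : R -> R) :
  has_derive_itv R a b f1 g1 -> has_derive_itv R a b f2 g2 ->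
  has_derive_itv R a b (fun x => f1 x * f2 x)
    (fun x => g1 x * f2 x + f1 x * g2 x).
Proof.
move=> fg1 fg2 t tab.
have c2 := has_derive_itv_cvg R a b f2 g2 t fg2 tab.
apply: cvg_trans (cvgD (cvgM (fg1 t tab) c2) (cvgM (cvg_cst (f1 t)) (fg2 t tab))).
by apply: near_eq_cvg; near=> s; rewrite !fctE /=; ring.
Unshelve. all: by end_near. Qed.

Lemma is_derive_has_derive_itv (R : realType) (a b : R) (f g : R -> R) :
  {in `[a, b], forall t : R, is_derive t 1 f (g t)} -> has_derive_itv R a b f g.
Proof.
move=> dfg t tab; have dt := dfg t tab.
have := @ex_derive _ _ _ _ _ _ _ dt; rewrite /derivable.
have := @derive_val _ _ _ _ _ _ _ dt; rewrite /derive => <- /cvg_ex[l fl].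
have -> : lim (h^-1 *: (f (h *: (1 : R) + t) - f t) @[h --> 0^']) = l.
  exact: cvg_lim fl.
have idt : (fun s : R => s - t) @ within `[a, b] t^' --> 0^'.
  move=> A /= [e /= e0 H]; exists e => //= s; rewrite /ball/= => ts st sab.
  by apply: H; rewrite /= ?subr_eq0// sub0r opprB.
have := cvg_comp _ _ idt fl.
apply: cvg_trans; apply: near_eq_cvg; near=> s => /=.
by rewrite /GRing.scale/= mulr1 subrK mulrC.
Unshelve. all: by end_near. Qed.

Lemma has_derive_itv_is_derive (R : realType) (a b : R) (f g : R -> R) (t : R) :
  has_derive_itv R a b f g -> t \in `]a, b[ -> is_derive t 1 f (g t).
Proof.
move=> fg tab.
have tab' : t \in `[a, b] by exact: subset_itv_oo_cc tab.
have idt : (fun h : R => h *: (1 : R) + t) @ 0^' --> within `[a, b] t^'.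
  move=> A; rewrite /within/= => -[e /= e0 H].
  have [d /= d0 Hd] : \forall s \near t, s \in `]a, b[ by exact: near_in_itvoo.
  exists (Num.min e d); first by rewrite /= lt_min e0 d0.
  move=> h; rewrite /ball/= sub0r normrN lt_min => /andP[he hd] h0.
  rewrite /GRing.scale/= mulr1; apply: H => /=.
  - by rewrite opprD addrCA subrr addr0 normrN.
  - by rewrite -subr_eq0 addrK.
  - apply: subset_itv_oo_cc; apply: Hd => /=.
    by rewrite opprD addrCA subrr addr0 normrN.
have cq : h^-1 *: (f (h *: (1 : R) + t) - f t) @[h --> 0^'] --> g t.
  have := cvg_comp _ _ idt (fg t tab'); apply: cvg_trans.
  apply: near_eq_cvg; near=> h => /=.
  by rewrite addrK /GRing.scale/= mulr1 mulrC.
apply: DeriveDef; first by apply/cvg_ex; exists (g t).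
exact: cvg_lim cq.
Unshelve. all: by end_near. Qed.

Lemma cont_diff_itv_eq (R : realType) (a b : R) (n : nat) (f1 f2 : R -> R) :
  {in `[a, b], f1 =1 f2} ->
  cont_diff_itv R a b n f1 -> cont_diff_itv R a b n f2.
Proof.
case: n => [|n] ef /=.
  apply: subspace_eq_continuous => x; rewrite mem_setE => xab.
  exact: ef.
move=> [g [fg Cg]]; exists g; split => //.
exact: has_derive_itv_eq fg.
Qed.

Lemma cont_diff_itvW (R : realType) (a b : R) (n : nat) (f : R -> R) :
  cont_diff_itv R a b n.+1 f -> cont_diff_itv R a b n f.
Proof.
elim: n f => [|n IHn] f [g [fg Cg]]; first exact: has_derive_itv_continuous fg.
by exists g; split => //; exact: IHn.
Qed.

Lemma cont_diff_itvD (R : realType) (a b : R) (n : nat) (f1 f2 : R -> R) :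
  cont_diff_itv R a b n f1 -> cont_diff_itv R a b n f2 ->
  cont_diff_itv R a b n (fun x => f1 x + f2 x).
Proof.
elim: n f1 f2 => [|n IHn] f1 f2 /=.
  by move=> c1 c2 x; apply: cvgD; [exact: c1|exact: c2].
move=> [g1 [fg1 C1]] [g2 [fg2 C2]]; exists (fun x => g1 x + g2 x).
by split; [exact: has_derive_itvD|exact: IHn].
Qed.

Lemma has_derive_itvZ (R : realType) (a b k : R) (f g : R -> R) :
  has_derive_itv R a b f g ->
  has_derive_itv R a b (fun x => k * f x) (fun x => k * g x).
Proof.
move=> fg.
have ck : has_derive_itv R a b (cst k) (cst 0).
  by apply: is_derive_has_derive_itv => x _; exact: is_derive_cst.
apply: has_derive_itv_eq (has_derive_itvM R a b _ _ _ _ ck fg) => // x _ /=.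
by rewrite mul0r add0r.
Qed.

Lemma cont_diff_itvZ (R : realType) (a b k : R) (n : nat) (f : R -> R) :
  cont_diff_itv R a b n f -> cont_diff_itv R a b n (fun x => k * f x).
Proof.
elim: n f => [|n IHn] f /=.
  by move=> c x; apply: cvgM; [exact: cvg_cst|exact: c].
move=> [g [fg C]]; exists (fun x => k * g x).
by split; [exact: has_derive_itvZ|exact: IHn].
Qed.

Lemma has_derive_itv_powR (R : realType) (a b r : R) : 0 < a ->
  has_derive_itv R a b (@powR R ^~ r) (fun x => r * x `^ (r - 1)).
Proof.
move=> a0; apply: is_derive_has_derive_itv => x; rewrite in_itv/= => /andP[ax _].
by apply: is_derive_powR; exact: lt_le_trans ax.
Qed.

(** The exponent r has to vary in the induction: the derivative of x^r f
    involves x^(r-1) f. *)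
Lemma cont_diff_itv_powRM (R : realType) (a b r : R) (n : nat) (f : R -> R) :
  0 < a -> cont_diff_itv R a b n f ->
  cont_diff_itv R a b n (fun x => x `^ r * f x).
Proof.
move=> a0; elim: n r f => [|n IHn] r f /=.
  move=> c x; apply: cvgM; last exact: c.
  exact: (has_derive_itv_continuous R a b _ _ (has_derive_itv_powR R a b r a0)).
move=> Cf; have [g [fg Cg]] := Cf.
exists (fun x => r * x `^ (r - 1) * f x + x `^ r * g x); split.
  by apply: has_derive_itvM => //; exact: has_derive_itv_powR.
apply: cont_diff_itvD; last exact: IHn.
have := cont_diff_itvZ R a b r n _ (IHn (r - 1) f (cont_diff_itvW R a b n f Cf)).
by apply: cont_diff_itv_eq => x _; rewrite mulrA.
Qed.

Lemma is_Cn_cont_diff (R : realType) (a b : R) (n : nat) (f : R -> R) :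
  is_Cn a b n f -> cont_diff_itv R a b n f.
Proof.
elim: n f => [|n IHn] f [df cf]; first exact: cf.
exists (derive_itv a b f); split; first by move=> t tab; exact: (df 0%N).
apply: IHn; split; last by rewrite /derive_itvn -iterSr.
by move=> k kn t tab; have := df k.+1 kn t tab; rewrite /derive_itvn iterSr.
Qed.

Lemma kat_diffE (R : realType) (a b rho : R) (f g : R -> R) : a < b ->
  has_derive_itv R a b f g ->
  {in `[a, b], kat_diff a b rho f =1 (fun x => x `^ (1 - rho) * g x)}.
Proof. by move=> ab fg x xab; rewrite /kat_diff (derive_itvE R a b f g x ab fg). Qed.

Lemma cont_diff_kat_diff (R : realType) (a b rho : R) (n : nat) (f : R -> R) :
  0 < a -> a < b -> cont_diff_itv R a b n.+1 f ->
  cont_diff_itv R a b n (kat_diff a b rho f).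
Proof.
move=> a0 ab [g [fg Cg]].
apply: cont_diff_itv_eq (cont_diff_itv_powRM R a b (1 - rho) n g a0 Cg) => x xab.
by rewrite (kat_diffE R a b rho f g ab fg).
Qed.

Lemma cont_diff_kat_diffn (R : realType) (a b rho : R) (k n : nat) (f : R -> R) :
  0 < a -> a < b -> cont_diff_itv R a b (k + n) f ->
  cont_diff_itv R a b n (kat_diffn a b rho k f).
Proof.
move=> a0 ab; elim: k n => [//|k IHk] n; rewrite addSnnS => /IHk.
exact: cont_diff_kat_diff.
Qed.

(** The weight x^(1-rho) of the operator can be undone, since x > 0. *)
Lemma has_derive_kat_diff (R : realType) (a b rho : R) (n : nat) (f : R -> R) :
  0 < a -> a < b -> cont_diff_itv R a b n.+1 f ->
  has_derive_itv R a b f (fun x => x `^ (rho - 1) * kat_diff a b rho f x).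
Proof.
move=> a0 ab [g [fg _]]; apply: has_derive_itv_eq (fg) => // x xab.
rewrite (kat_diffE R a b rho f g ab fg)// mulrA -powRD.
  by rewrite (_ : _ + _ = 0) ?powRr0 ?mul1r//; ring.
apply/implyP => _; rewrite gt_eqF//.
by move: xab; rewrite in_itv/= => /andP[+ _]; exact: lt_le_trans.
Qed.

Lemma kat_diff_oppnE (R : realType) (a b rho : R) (k n : nat) (f : R -> R) :
  0 < a -> a < b -> cont_diff_itv R a b (k + n) f ->
  {in `[a, b], kat_diff_oppn a b rho k f =1
     (fun x => (-1) ^+ k * kat_diffn a b rho k f x)}.
Proof.
move=> a0 ab; elim: k n => [|k IHk] n Cf x xab; first by rewrite expr0 mul1r.
rewrite addSnnS in Cf; have [g [fg _]] := cont_diff_kat_diffn R a b rho k n.+1 f a0 ab Cf.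
have fg' : has_derive_itv R a b (kat_diff_oppn a b rho k f) (fun x => (-1) ^+ k * g x).
  apply: has_derive_itv_eq (has_derive_itvZ R a b ((-1) ^+ k) _ _ fg) => // z zab.
  by rewrite (IHk n.+1 Cf).
rewrite /= /kat_diff_opp (derive_itvE R a b _ _ x ab fg' xab).
by rewrite /kat_diff (derive_itvE R a b _ _ x ab fg xab) exprS; ring.
Qed.

(** * Taylor formula with integral remainder *)

Lemma integral_has_derive_itv (R : realType) (a b s u : R) (F f : R -> R) :
  has_derive_itv R a b F f -> {within `[a, b], continuous f} ->
  s \in `[a, b] -> u \in `[a, b] -> s <= u ->
  (\int[lebesgue_measure]_(x in `]s, u[) (f x)%:E = (F u - F s)%:E)%E.
Proof.
move=> Ff cf sab uab; rewrite le_eqVlt => /predU1P[<-|su].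
  by rewrite set_itvoo0 integral_set0 subrr.
have sub : `[s, u]%classic `<=` `[a, b]%classic.
  by apply: subset_itvScc; rewrite bnd_simp;
    [move: sab|move: uab]; rewrite in_itv/= => /andP[].
have csu := continuous_subspaceW sub cf.
have cF := continuous_subspaceW sub (has_derive_itv_continuous R a b F f Ff).
have dF x : x \in `]s, u[ -> is_derive x 1 F (f x).
  move=> xsu; apply: (has_derive_itv_is_derive R a b F f x Ff).
  by apply: subset_itvSoo xsu; rewrite bnd_simp;
    [move: sab|move: uab]; rewrite in_itv/= => /andP[].
have [_ Fs Fu] := (continuous_within_itvP F su).1 cF.
rewrite -(integral_itv_bndoo true false); last first.
  apply/measurable_EFinP.
  apply: measurable_funS (subspace_continuous_measurable_fun _ csu) => //.
  exact: subset_itv_oo_cc.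
rewrite (continuous_FTC2 su csu (F := F)) ?EFinB//.
  by split => // x /dF ?; exact: ex_derive.
by move=> x /dF ?; rewrite derive1E; exact: derive_val.
Qed.

Lemma continuous_itv_bounded (R : realType) (a b : R) (f : R -> R) : a <= b ->
  {within `[a, b], continuous f} ->
  exists M, forall x, x \in `[a, b] -> `|f x| <= M.
Proof.
move=> ab cf; have cnf : {within `[a, b], continuous (fun x => `|f x|)}.
  by move=> x; apply: cvg_norm; exact: cf.
have [c _ fc] := EVT_max ab cnf.
by exists `|f c|.
Qed.

Lemma has_derive_itvX (R : realType) (a b : R) (k : nat) (f g : R -> R) :
  has_derive_itv R a b f g ->
  has_derive_itv R a b (fun x => f x ^+ k.+1)
    (fun x => k.+1%:R * f x ^+ k * g x).
Proof.
move=> fg; elim: k => [|k IHk].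
  by apply: has_derive_itv_eq (fg) => // x _; rewrite ?expr1// expr0 !mul1r.
apply: has_derive_itv_eq (has_derive_itvM R a b _ _ _ _ fg IHk) => // x _.
by rewrite -(natr1 k.+1) exprS; ring.
Qed.

(** The Taylor sum at t as a function of its expansion point s. *)
Definition taylor_kat (R : realType) (a b rho t : R) (n : nat) (x : R -> R) : R -> R :=
  fun s => \sum_(k < n) (rho ^- k / (k`!)%:R * (t `^ rho - s `^ rho) ^+ k *
                          kat_diffn a b rho k x s).

(** Differentiating the power in the term of index k + 1 cancels the derivative
    of the factor D^k x in the term of index k; only the last one survives. *)
Lemma has_derive_taylor_kat (R : realType) (a b rho t : R) (m : nat) (x : R -> R) :
  0 < a -> a < b -> 0 < rho -> cont_diff_itv R a b m.+1 x ->
  has_derive_itv R a b (taylor_kat R a b rho t m.+1 x)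
    (fun s => rho ^- m / (m`!)%:R *
      ((t `^ rho - s `^ rho) ^+ m * (s `^ (rho - 1) * kat_diffn a b rho m.+1 x s))).
Proof.
move=> a0 ab rho0; elim: m => [|m IHm] Cx.
  have := has_derive_kat_diff R a b rho 0 x a0 ab Cx.
  apply: has_derive_itv_eq => s sab.
    by rewrite /taylor_kat big_ord1 fact0 !expr0 mulr1n divr1 invr1 !mul1r.
  by rewrite fact0 !expr0 mulr1n divr1 invr1 !mul1r.
have dX : has_derive_itv R a b (kat_diffn a b rho m.+1 x)
    (fun s => s `^ (rho - 1) * kat_diffn a b rho m.+2 x s).
  apply: (has_derive_kat_diff R a b rho 0) => //.
  by apply: cont_diff_kat_diffn => //; rewrite addn1.
have dd : has_derive_itv R a b (fun s => t `^ rho - s `^ rho)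
    (fun s => - 1 * (rho * s `^ (rho - 1))).
  have dt : has_derive_itv R a b (cst (t `^ rho)) (cst 0).
    by apply: is_derive_has_derive_itv => s _; exact: is_derive_cst.
  have := has_derive_itvD R a b _ _ _ _ dt
    (has_derive_itvZ R a b (-1) _ _ (has_derive_itv_powR R a b rho a0)).
  by apply: has_derive_itv_eq => s _ /=; [rewrite mulN1r|rewrite add0r].
have := has_derive_itvD R a b _ _ _ _ (IHm (cont_diff_itvW R a b m.+1 x Cx))
  (has_derive_itvZ R a b (rho ^- m.+1 / (m.+1`!)%:R) _ _
    (has_derive_itvM R a b _ _ _ _ (has_derive_itvX R a b m _ _ dd) dX)).
apply: has_derive_itv_eq => s _.
  by rewrite /taylor_kat [in RHS]big_ord_recr /= mulrA.
have r0 : rho != 0 by rewrite gt_eqF.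
have f0 : (m`!)%:R != 0 :> R by rewrite pnatr_eq0 -lt0n fact_gt0.
have m0 : m.+1%:R != 0 :> R by rewrite pnatr_eq0.
rewrite factS natrM exprS [(_ - _) ^+ m.+1]exprS.
have rm0 : rho ^+ m != 0 by rewrite expf_neq0.
move: (kat_diffn a b rho m.+1 x s) (kat_diffn a b rho m.+2 x s) => y1 y2.
move: (t `^ rho - s `^ rho) (s `^ (rho - 1)) (rho ^+ m) rm0 => d w r rm0.
move: (m`!%:R) f0 (m.+1%:R) m0 => f f0 M m0; move: (d ^+ m) => dm.
by field; rewrite r0 f0 m0 rm0.
Qed.

(** Passing to open intervals discards the point t, where the truncated power
    and the ordinary one differ when m = 0. *)
Lemma kernel_operator_leftE (R : realType) (a b rho t : R) (m : nat) (y : R -> R) :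
  0 < a -> 0 < rho -> t \in `[a, b] -> measurable_fun `[a, b] y ->
  kernel_operator R a b (fun t s => t `^ rho - s `^ rho) (@powR R ^~ (rho - 1))
    m.+1%:R y t =
  \int[lebesgue_measure]_(s in `]a, t[)
    ((t `^ rho - s `^ rho) ^+ m * (s `^ (rho - 1) * y s)).
Proof.
move=> a0 rho0 tab my; have := tab; rewrite in_itv/= => /andP[at_ tb].
pose F s := truncated_power R m.+1%:R (t `^ rho - s `^ rho) * s `^ (rho - 1) * y s.
have mF : measurable_fun (`]a, b[%classic : set R) (EFin \o F).
  apply/measurable_EFinP; apply: measurable_funM.
    apply: measurable_funTS; apply: measurable_funM; last exact: measurable_powR.
    apply: measurable_truncated_power_comp.
    exact: (measurable_funB (measurable_cst _) (measurable_powR rho)).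
  by apply: measurable_funS my => //; exact: subset_itv_oo_cc.
rewrite /kernel_operator /Rintegral; congr fine.
transitivity (\int[lebesgue_measure]_(s in `]a, b[) (F s)%:E)%E.
  exact: (integral_itv_bndoo true false mF).
rewrite [LHS]integral_mkcond [RHS]integral_mkcond; apply: eq_integral => s _.
rewrite !patchE /F; case: ifPn => [/set_mem sab|/negP sab]; last first.
  rewrite ifF//; apply/negP => /set_mem sat; apply/sab/mem_set.
  by apply: subset_itvSoo sat; rewrite bnd_simp.
have sab' : s \in `[a, b] by exact: subset_itv_oo_cc sab.
have E := powR_diff_itv R a b rho s t a0 rho0 sab' tab.
have E' := powR_diff_itv R a b rho t s a0 rho0 tab sab'.
have [st|ts] := ltP s t.
  rewrite ifT; last first.
    by apply/mem_set; move: sab; rewrite /= !in_itv/= st => /andP[->].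
  rewrite truncated_power_gt0; last by rewrite subr_gt0 ltNge -subr_ge0 E' -ltNge.
  by rewrite -natr1 addrK powR_mulrn ?E ?ltW// mulrA.
rewrite ifF; last first.
  by apply/negP => /set_mem; rewrite /= in_itv/= => /andP[_]; rewrite ltNge ts.
by rewrite truncated_power_le0 ?mul0r// subr_le0 -subr_ge0 E'.
Qed.

Lemma kernel_operator_rightE (R : realType) (a b rho t : R) (m : nat) (y : R -> R) :
  0 < a -> 0 < rho -> t \in `[a, b] -> measurable_fun `[a, b] y ->
  kernel_operator R a b (fun t s => s `^ rho - t `^ rho) (@powR R ^~ (rho - 1))
    m.+1%:R y t =
  \int[lebesgue_measure]_(s in `]t, b[)
    ((s `^ rho - t `^ rho) ^+ m * (s `^ (rho - 1) * y s)).
Proof.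
move=> a0 rho0 tab my; have := tab; rewrite in_itv/= => /andP[at_ tb].
pose F s := truncated_power R m.+1%:R (s `^ rho - t `^ rho) * s `^ (rho - 1) * y s.
have mF : measurable_fun (`]a, b[%classic : set R) (EFin \o F).
  apply/measurable_EFinP; apply: measurable_funM.
    apply: measurable_funTS; apply: measurable_funM; last exact: measurable_powR.
    apply: measurable_truncated_power_comp.
    exact: (measurable_funB (measurable_powR rho) (measurable_cst _)).
  by apply: measurable_funS my => //; exact: subset_itv_oo_cc.
rewrite /kernel_operator /Rintegral; congr fine.
transitivity (\int[lebesgue_measure]_(s in `]a, b[) (F s)%:E)%E.
  exact: (integral_itv_bndoo true false mF).
rewrite [LHS]integral_mkcond [RHS]integral_mkcond; apply: eq_integral => s _.
rewrite !patchE /F; case: ifPn => [/set_mem sab|/negP sab]; last first.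
  rewrite ifF//; apply/negP => /set_mem sat; apply/sab/mem_set.
  by apply: subset_itvSoo sat; rewrite bnd_simp.
have sab' : s \in `[a, b] by exact: subset_itv_oo_cc sab.
have E := powR_diff_itv R a b rho s t a0 rho0 sab' tab.
have E' := powR_diff_itv R a b rho t s a0 rho0 tab sab'.
have [ts|st] := ltP t s.
  rewrite ifT; last first.
    by apply/mem_set; move: sab; rewrite /= !in_itv/= ts => /andP[_ ->].
  rewrite truncated_power_gt0; last by rewrite subr_gt0 ltNge -subr_ge0 E -ltNge.
  by rewrite -natr1 addrK powR_mulrn ?E' ?ltW// mulrA.
rewrite ifF; last first.
  by apply/negP => /set_mem; rewrite /= in_itv/= ltNge st.
by rewrite truncated_power_le0 ?mul0r// subr_le0 -subr_ge0 E.
Qed.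

Lemma taylor_kat_diag (R : realType) (a b rho t : R) (m : nat) (x : R -> R) :
  taylor_kat R a b rho t m.+1 x t = x t.
Proof.
rewrite /taylor_kat big_ord_recl /= !expr0 fact0 mulr1n divr1 invr1 !mul1r.
rewrite big1 ?addr0// => k _.
by rewrite subrr expr0n/= mulr0 mul0r.
Qed.

(** The factor k is 1 for the left-sided formula and -1 for the right-sided
    one. *)
Lemma integral_taylor_kat (R : realType) (a b rho t k : R) (m : nat)
    (x : R -> R) (s u : R) :
  0 < a -> a < b -> 0 < rho -> cont_diff_itv R a b m.+1 x ->
  s \in `[a, b] -> u \in `[a, b] -> s <= u ->
  (\int[lebesgue_measure]_(r in `]s, u[)
    (k * ((t `^ rho - r `^ rho) ^+ m *
       (r `^ (rho - 1) * kat_diffn a b rho m.+1 x r)))%:E =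
   (k * ((rho ^- m / (m`!)%:R)^-1 *
     (taylor_kat R a b rho t m.+1 x u - taylor_kat R a b rho t m.+1 x s)))%:E)%E.
Proof.
move=> a0 ab rho0 Cx sab uab su.
have cX : {within `[a, b], continuous (kat_diffn a b rho m.+1 x)}.
  by apply: (cont_diff_kat_diffn R a b rho m.+1 0 x a0 ab); rewrite addn0.
set c := rho ^- m / _; have c0 : c != 0.
  by rewrite gt_eqF// divr_gt0 ?invr_gt0 ?exprn_gt0// ltr0n fact_gt0.
have dT : has_derive_itv R a b (fun s => k * c^-1 * taylor_kat R a b rho t m.+1 x s)
    (fun s => k * ((t `^ rho - s `^ rho) ^+ m *
       (s `^ (rho - 1) * kat_diffn a b rho m.+1 x s))).
  apply: has_derive_itv_eq (has_derive_itvZ R a b (k * c^-1) _ _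
    (has_derive_taylor_kat R a b rho t m x a0 ab rho0 Cx)) => // r _.
  by rewrite -/c -mulrA mulKf.
have cpow r : {within `[a, b], continuous (@powR R ^~ r)}.
  exact: (has_derive_itv_continuous R a b _ _ (has_derive_itv_powR R a b r a0)).
rewrite (integral_has_derive_itv R a b s u _ _ dT _ sab uab su).
  by congr EFin; ring.
move=> r; apply: cvgM; first exact: cvg_cst.
apply: cvgM; last by apply: cvgM; [exact: cpow|exact: cX].
apply: (@continuous_comp (subspace `[a, b]%classic) R R
  (fun r => t `^ rho - r `^ rho) (fun z => z ^+ m)).
  by apply: cvgB; [exact: cvg_cst|exact: cpow].
exact: exprn_continuous.
Qed.

(** * The Katugampola integral of the Caputo-Katugampola derivative *)

Theorem theorem4 (R : realType) (a b rho alpha : R) (n : nat) (x : R -> R)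
    (a_gt0 : 0 < a) (ab : a < b) (rho_gt0 : 0 < rho) (alpha_gt0 : 0 < alpha)
    (alphan : n%:R - 1 < alpha < n%:R) (xCn : is_Cn a b n x) :
  forall t : R, t \in `[a, b] ->
    kat_int_left a alpha rho (caputo_kat_left a b n alpha rho x) t =
      x t - \sum_(k < n) (rho ^- k / (k`!)%:R * (t `^ rho - a `^ rho) ^+ k *
                          kat_diffn a b rho k x a)
    /\
    kat_int_right b alpha rho (caputo_kat_right a b n alpha rho x) t =
      x t - \sum_(k < n) (rho ^- k * (-1) ^+ k / (k`!)%:R *
                          (b `^ rho - t `^ rho) ^+ k *
                          kat_diffn a b rho k x b).
Proof.
have Cx := is_Cn_cont_diff R a b n x xCn.
case: n alphan Cx {xCn} => [/andP[_ al0]|m /andP[nal aln] Cx].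
  by have := lt_trans alpha_gt0 al0; rewrite ltxx.
have q0 : 0 < m.+1%:R - alpha by rewrite subr_gt0.
(* Neither order is 1, as alpha is not an integer. *)
have q1 : m.+1%:R - alpha != 1.
  by rewrite lt_eqF// ltrBlDr -ltrBlDl.
have p1 : alpha != 1.
  apply/eqP => alpha1; move: nal aln; rewrite alpha1 -natr1 addrK.
  by rewrite -[X in _ < X]/(1%:R) ltr_nat ltnS leqn0 => /eqP ->; rewrite add0r ltxx.
have cX : {within `[a, b], continuous (kat_diffn a b rho m.+1 x)}.
  by apply: (cont_diff_kat_diffn R a b rho m.+1 0 x a_gt0 ab); rewrite addn0.
have oppE : {in `[a, b], kat_diff_oppn a b rho m.+1 x =1
    (fun s => (-1) ^+ m.+1 * kat_diffn a b rho m.+1 x s)}.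
  by apply: (kat_diff_oppnE R a b rho m.+1 0 x a_gt0 ab); rewrite addn0.
have cY : {within `[a, b], continuous (kat_diff_oppn a b rho m.+1 x)}.
  apply: (cont_diff_itv_eq R a b 0 _ _ _ (cont_diff_itvZ R a b ((-1) ^+ m.+1) 0 _ cX)).
  by move=> s sab; rewrite oppE.
have mX := subspace_continuous_measurable_fun (measurable_itv _) cX.
have mY := subspace_continuous_measurable_fun (measurable_itv _) cY.
have [M XM] := continuous_itv_bounded R a b _ (ltW ab) cX.
have [N YN] := continuous_itv_bounded R a b _ (ltW ab) cY.
have cstE : rho `^ (1 - m.+1%:R) / Gamma (m.+1%:R : R) = rho ^- m / (m`!)%:R.
  by rewrite Gamma_nat -natr1 opprD addrCA subrr addr0 powR_invn// ltW.
have c0 : rho ^- m / (m`!)%:R != 0.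
  by rewrite gt_eqF// divr_gt0 ?invr_gt0 ?exprn_gt0// ltr0n fact_gt0.
move=> t tab; have := tab; rewrite in_itv/= => /andP[at_ tb].
have prim k s u := integral_taylor_kat R a b rho t k m x s u a_gt0 ab rho_gt0 Cx.
have aab : a \in `[a, b] by rewrite in_itv/= lexx ltW.
have bab : b \in `[a, b] by rewrite in_itv/= lexx ltW.
split.
  rewrite /caputo_kat_left.
  rewrite (kat_int_left_comp R a b rho alpha (m.+1%:R - alpha) t M)//.
  rewrite subrKC cstE kernel_operator_leftE// /Rintegral.
  under eq_integral do rewrite -[X in X%:E]mul1r.
  by rewrite prim// mul1r/= mulVKf// taylor_kat_diag.
rewrite /caputo_kat_right.
rewrite (kat_int_right_comp R a b rho alpha (m.+1%:R - alpha) t N)//.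
rewrite subrKC cstE kernel_operator_rightE// /Rintegral.
have -> : (\int[lebesgue_measure]_(s in `]t, b[)
    ((s `^ rho - t `^ rho) ^+ m *
      (s `^ (rho - 1) * kat_diff_oppn a b rho m.+1 x s))%:E =
  \int[lebesgue_measure]_(s in `]t, b[)
    (-1 * ((t `^ rho - s `^ rho) ^+ m *
      (s `^ (rho - 1) * kat_diffn a b rho m.+1 x s)))%:E)%E.
  apply: eq_integral => s /set_mem stb; congr EFin.
  have sab : s \in `[a, b].
    by apply: subset_itv_oo_cc; apply: subset_itvSoo stb; rewrite bnd_simp.
  (* (-1)^m from the kernel and (-1)^(m+1) from the derivative leave -1. *)
  have sgn : (-1) ^+ m * (-1) ^+ m = 1 :> R by rewrite -exprMn mulrNN mulr1 expr1n.
  rewrite oppE// -[s `^ rho - t `^ rho]opprB [(- (_ - _)) ^+ m]exprNn exprS.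
  move: sgn; set e := (-1) ^+ m => sgn.
  transitivity (e * e * (- ((t `^ rho - s `^ rho) ^+ m *
    (s `^ (rho - 1) * kat_diffn a b rho m.+1 x s)))); first by ring.
  by rewrite sgn; ring.
rewrite prim//= mulN1r mulrN mulVKf// opprB taylor_kat_diag; congr (_ - _).
apply: eq_bigr => k _; rewrite -[t `^ rho - _]opprB [(- (_ - _)) ^+ k]exprNn.
by ring.
Qed.
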